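(* Let $d\ge1$ and let $Y_0$ be the value at $x=0$ of the mild solution to the stochastic heat equation with additive Lévy noise of mean $m$ and Lévy measure $\lambda$ (see context). Let $\varepsilon>0$ be such that $\int_{\mathbb{R}}|z|^{1+\varepsilon}\,\lambda(dz)<\infty$, and assume $\int_{-1}^1|z\log|z||\,\lambda(dz)<\infty$. Then for every $p\in(0,1+\varepsilon]\cap(0,1+2/d)$, $$\frac{Y_0(t)}{t}\longrightarrow m\quad\text{in }L^p\text{ as }t\to\infty,$$ that is, $\mathbb{E}\big[|Y_0(t)/t-m|^p\big]\to0$ as $t\to\infty$.
   Context: The heat kernel on $\mathbb{R}^d$ is $g(t,x)=(4\pi t)^{-d/2}e^{-|x|^2/(4t)}$ for $t>0$, and $g(t,x)=0$ for $t\le 0$. Let $\lambda$ be a Lévy measure on $\mathbb{R}$ (so $\lambda(\{0\})=0$), not identically zero, with $\int_{\mathbb{R}}|z|\,\lambda(dz)<\infty$. Let $\mu$ be a Poisson random measure on $(0,\infty)\times\mathbb{R}^d\times\mathbb{R}$ with intensity $dt\,dx\,\lambda(dz)$ and points $(\tau_i,\eta_i,\zeta_i)_{i\in\mathbb{N}}$. Let $m\in\mathbb{R}$ (the mean of the noise) and $m_0=m-\int_{\mathbb{R}}z\,\lambda(dz)$ (the drift). The Lévy space-time white noise without Gaussian part is $\Lambda(dt,dx)=m_0\,dt\,dx+\int_{\mathbb{R}}z\,\mu(dt,dx,dz)$. The mild solution to $\partial_tY=\Delta Y+\dot\Lambda$ on $(0,\infty)\times\mathbb{R}^d$, $Y(0,\cdot)=0$,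 is $Y(t,x)=\int_0^t\int_{\mathbb{R}^d}g(t-s,x-y)\,\Lambda(ds,dy)$, so that $Y_0(t)=Y(t,0)=m_0t+\sum_{\tau_i\le t}g(t-\tau_i,\eta_i)\zeta_i$. *)

(* Defs.v *)
From HB Require Import structures.
From mathcomp Require Import all_boot all_order all_algebra.
From mathcomp Require Import all_classical all_reals all_analysis.
From mathcomp Require Import measurable_realfun.
Set Implicit Arguments.
Unset Strict Implicit.
Unset Printing Implicit Defensive.
Import Order.TTheory GRing.Theory Num.Theory.
Import numFieldNormedType.Exports.
Local Open Scope classical_set_scope.
Local Open Scope ring_scope.

Lemma product_measure1_sigma_finite d1 d2 (T1 : measurableType d1)
    (T2 : measurableType d2) (R : realType)
    (m1 : {sigma_finite_measure set T1 -> \bar R})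
    (m2 : {sigma_finite_measure set T2 -> \bar R}) :
  sigma_finite setT (m1 \x m2)%E.
Proof.
have /sigma_finiteP[F [TF ndF Foo]] := sigma_finiteT m1.
have /sigma_finiteP[G [TG ndG Goo]] := sigma_finiteT m2.
exists (fun n => F n `*` G n).
  rewrite -setXTT TF TG predeqE => -[x y]; split.
    move=> [/= [n _ Fnx] [k _ Gky]]; exists (maxn n k) => //; split.
    - by move: x Fnx; exact/subsetPset/ndF/leq_maxl.
    - by move: y Gky; exact/subsetPset/ndG/leq_maxr.
  by move=> [n _ []/= ? ?]; split; exists n.
move=> k; have [? ?] := Foo k; have [? ?] := Goo k.
split; first exact: measurableX.
by rewrite [X in (X < _)%E]product_measure1E// lte_mul_pinfty// ge0_fin_numE.
Qed.

Section lebesgue_tuple.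
Context {R : realType}.
Local Notation T := (measurableTypeR R).

Definition tcons n (u : T * n.-tuple T) : n.+1.-tuple T :=
  [the n.+1.-tuple T of u.1 :: u.2].

Definition tuncons n (x : n.+1.-tuple T) : T * n.-tuple T :=
  (thead x, [tuple of behead x]).

Lemma tconsK n : cancel (@tcons n) (@tuncons n).
Proof. by case=> a y; congr pair; apply/val_inj. Qed.

Lemma tunconsK n : cancel (@tuncons n) (@tcons n).
Proof. by move=> x; rewrite [RHS](tuple_eta x). Qed.

Lemma measurable_tcons n : measurable_fun setT (@tcons n).
Proof. exact: measurable_cons. Qed.

Lemma measurable_tuncons n : measurable_fun setT (@tuncons n).
Proof.
by apply: measurable_fun_pair; [exact: measurable_tnth|exact: measurable_behead].
Qed.

Section step.
Variables (n : nat) (m : {sigma_finite_measure set (n.-tuple T) -> \bar R}).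

Definition lebesgue_tcons : set (n.+1.-tuple T) -> \bar R :=
  pushforward (@lebesgue_measure R \x m)%E (@tcons n).

Let lebesgue_tcons0 : lebesgue_tcons set0 = 0%E.
Proof. by rewrite /lebesgue_tcons /pushforward preimage_set0 measure0. Qed.

Let lebesgue_tcons_ge0 A : (0 <= lebesgue_tcons A)%E.
Proof. exact: (measure_ge0 (@lebesgue_measure R \x m)%E). Qed.

Let lebesgue_tcons_sigma_additive : semi_sigma_additive lebesgue_tcons.
Proof.
move=> F mF tF mUF; rewrite /lebesgue_tcons /pushforward preimage_bigcup.
apply: measure_semi_sigma_additive.
- by move=> k; rewrite -[X in measurable X]setTI; exact: measurable_tcons.
- apply/trivIsetP => /= i j _ _ ij; rewrite -preimage_setI.
  by move/trivIsetP : tF => /(_ _ _ _ _ ij) ->//; rewrite preimage_set0.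
- by rewrite -preimage_bigcup -[X in measurable X]setTI; exact: measurable_tcons.
Qed.

HB.instance Definition _ := isMeasure.Build _ _ _ lebesgue_tcons
  lebesgue_tcons0 lebesgue_tcons_ge0 lebesgue_tcons_sigma_additive.

Let lebesgue_tcons_sigma_finite : sigma_finite setT lebesgue_tcons.
Proof.
have [F FT mF] := product_measure1_sigma_finite (@lebesgue_measure R) m.
exists (fun k => @tuncons n @^-1` F k).
  by rewrite -preimage_bigcup -FT preimage_setT.
move=> k; have [mFk Fk_fin] := mF k; split.
  by rewrite -[X in measurable X]setTI; exact: measurable_tuncons.
rewrite /lebesgue_tcons /pushforward -comp_preimage.
by rewrite (_ : _ \o _ = id)//; apply/funext => u /=; rewrite tconsK.
Qed.

HB.instance Definition _ := Measure_isSigmaFinite.Build _ _ _ lebesgue_tcons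
  lebesgue_tcons_sigma_finite.

End step.

(* Lebesgue measure on R^n, as the n-fold product of one-dimensional Lebesgue
   measures transported along (x_1, (x_2, .., x_n)) |-> (x_1, .., x_n). *)
Fixpoint lebesgue_tuple n : {sigma_finite_measure set (n.-tuple T) -> \bar R} :=
  if n is n'.+1 then lebesgue_tcons (lebesgue_tuple n')
  else \d_([tuple] : 0.-tuple T).

Lemma lebesgue_tuple_box n (A : 'I_n -> set T) :
  (forall i, measurable (A i)) ->
  lebesgue_tuple n [set x | forall i, A i (tnth x i)] =
  (\prod_(i < n) lebesgue_measure (A i))%E.
Proof.
elim: n A => [|n IH] A mA.
  rewrite big_ord0 /= diracE mem_set//; by case.
rewrite big_ord_recl /= /lebesgue_tcons /pushforward.
rewrite (_ : _ @^-1` _ =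
    A ord0 `*` [set y : n.-tuple T | forall i, A (lift ord0 i) (tnth y i)]).
  rewrite product_measure1E//.
    by congr (_ * _)%E; apply: (IH (fun i => A (lift ord0 i))) => i.
  have -> : [set y : n.-tuple T | forall i, A (lift ord0 i) (tnth y i)] =
      \bigcap_(i in [set: 'I_n]) ((@tnth n T ^~ i) @^-1` A (lift ord0 i)).
    by apply/seteqP; split => [y Ay i _|y Ay i]; [exact: Ay|exact: (Ay i)].
  apply: fin_bigcap_measurable => // i _.
  by rewrite -[X in measurable X]setTI; apply: measurable_tnth.
apply/seteqP; split => [[a y]/= Aay|[a y]/= [Aa Ay] i].
  by split; [exact: (Aay ord0)|move=> i; have := Aay (lift ord0 i); rewrite tnthS].
by case: (unliftP ord0 i) => [j ->|->//]; rewrite tnthS.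
Qed.

End lebesgue_tuple.

Section spacetime.
Context {R : realType} (d : nat).
Local Notation T := (measurableTypeR R).

Definition lebesgue_spacetime : set (T * d.-tuple T) -> \bar R :=
  (@lebesgue_measure R \x lebesgue_tuple d)%E.

HB.instance Definition _ := Measure.on lebesgue_spacetime.

(* [m1 \x m2] has no canonical sigma-finite structure for general sigma-finite
   [m1] and [m2], hence the explicit instance. *)
HB.instance Definition _ := Measure_isSigmaFinite.Build _ _ _
  lebesgue_spacetime
  (product_measure1_sigma_finite (@lebesgue_measure R) (lebesgue_tuple d)).

Definition tsub (x y : d.-tuple T) : d.-tuple T :=
  [tuple (tnth x i : R) - (tnth y i : R) | i < d].

Definition heat_kernel (t : R) (x : d.-tuple T) : R :=
  if 0 < t then
    (4 * pi * t) `^ (- (d%:R / 2)) *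
    expR (- (\sum_(i < d) (tnth x i : R) ^+ 2) / (4 * t))
  else 0.

End spacetime.
Arguments lebesgue_spacetime {R} d A.

Section levy_measure.
Context {R : realType}.

Definition is_levy_measure
    (lambda : {measure set (measurableTypeR R) -> \bar R}) : Prop :=
  lambda [set 0] = 0%E /\
  (\int[lambda]_z (Num.min 1 ((z : R) ^+ 2))%:E < +oo)%E.

End levy_measure.

Section poisson_random_measure.
Context {dO dE : measure_display} {Omega : measurableType dO}
  {E : measurableType dE} {R : realType} (P : probability Omega R).

(* Since the whole space is an allowed value for each [B i], the product rule
   for the full finite family contains those for its subfamilies. *)
Definition independent_family (n : nat) (X : 'I_n -> Omega -> \bar R) : Prop :=
  forall B : 'I_n -> set (\bar R), (forall i, measurable (B i)) ->
    P [set w | forall i, B i (X i w)] =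
    (\prod_(i < n) P [set w | B i (X i w)])%E.

(* The argument [0%N] of [poisson_prob] is a dummy of the library definition. *)
Record is_poisson_random_measure
    (N : Omega -> {measure set E -> \bar R}) (nu : set E -> \bar R) : Prop := {
  prm_measurable : forall A, measurable A ->
    measurable_fun setT (fun w => N w A) ;
  prm_poisson : forall A, measurable A -> (nu A < +oo)%E ->
    forall k : nat,
      P [set w | N w A = k%:R%:E] = poisson_prob (fine (nu A)) 0%N [set k] ;
  prm_infinite : forall A, measurable A -> nu A = +oo%E ->
    P [set w | N w A = +oo%E] = 1%E ;
  prm_independent : forall (n : nat) (A : 'I_n -> set E),
    (forall i, measurable (A i)) -> trivIset setT A ->
    independent_family (fun i w => N w (A i)) }.

End poisson_random_measure.

Section levy_noise.
Context {R : realType} {d : nat}.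
Local Notation T := (measurableTypeR R).

(* Random points are given on all of R x R^d x R; the intensity
   dt dx lambda(dz) is carried by positive times. *)
Definition noise_intensity
    (lambda : {measure set T -> \bar R})
    (A : set ((T * d.-tuple T) * T)) : \bar R :=
  (lebesgue_spacetime d \x^ lambda)%E (A `&` [set v | 0 < (v.1.1 : R)]).

Definition point_measure (tau : nat -> T) (eta : nat -> d.-tuple T)
    (zeta : nat -> T) : {measure set ((T * d.-tuple T) * T) -> \bar R} :=
  mseries (fun i => \d_((tau i, eta i), zeta i)) 0.

Definition noise_drift (lambda : {measure set T -> \bar R}) (m : R) : R :=
  m - \int[lambda]_(z in setT) (z : R).

(* Integral over D of f against m0 dt dx + int z mu(dt,dx,dz).  The second
   integral takes a default value where it is not absolutely convergent; for
   the Poisson points and the heat kernel this is a null event as soon as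
   [|z|] is lambda-integrable. *)
Definition noise_integral (m0 : R)
    (mu : {measure set ((T * d.-tuple T) * T) -> \bar R})
    (D : set (T * d.-tuple T)) (f : T * d.-tuple T -> R) : R :=
  m0 * \int[lebesgue_spacetime d]_(u in D) f u +
  \int[mu]_(v in D `*` setT) (f v.1 * (v.2 : R)).

Definition mild_solution (m0 : R)
    (mu : {measure set ((T * d.-tuple T) * T) -> \bar R})
    (t : R) (x : d.-tuple T) : R :=
  noise_integral m0 mu [set u | 0 < (u.1 : R) <= t]
    (fun u => heat_kernel (t - (u.1 : R)) (tsub x u.2)).

End levy_noise.

(* Main.v *)
Require Import Defs.
From HB Require Import structures.
From mathcomp Require Import all_boot all_order all_algebra.
From mathcomp Require Import all_classical all_reals all_analysis.
From mathcomp Require Import measurable_realfun.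
From mathcomp Require Import ring lra.
Set Implicit Arguments.
Unset Strict Implicit.
Unset Printing Implicit Defensive.
Import Order.TTheory GRing.Theory Num.Theory.
Import numFieldNormedType.Exports.
Local Open Scope classical_set_scope.
Local Open Scope ring_scope.

(** By the Mecke identity E[S phi(S)] = int h(v) E[phi(S + h(v))] nu(dv) for a
Poisson integral S of h >= 0 (with intensity nu), phi(x) = x gives the variance
of S, and phi(x) = x^(p-1) bounds E[S^p], for every p > 1, by a constant times
int (h + h^p) dnu as long as int h dnu stays bounded.  Take p > 1 and h = f / t,
with int f dnu = b t and int f^p dnu = o(t).  The part of f below 1 gives a Poisson
integral whose variance is O(1/t) and whose moment of order p + 1 is bounded, and
the part above 1 is negligible in L^p; hence S -> b in L^p.

The positive and the negative jumps are treated separately, with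
f(s, y, z) = g(t - s, y) z^+ and f(s, y, z) = g(t - s, y) z^-.  Since g(r, .) has
integral 1, int f dnu = t int z^(+/-) lambda(dz); since g(r, y) <= (4 pi r)^(-d/2),
int f^p dnu is at most of order t^(1 - d(p-1)/2), which is finite and o(t)
because 1 < p < 1 + 2/d.  Exponents p <= 1 follow from larger ones. *)

(** * The Mecke identity for finitely many Poisson counts *)

(** The obstacle is that the exponent may be below 2. Then int f^2 dnu can be infinite (g^2 is not
    integrable near s = t when d >= 2), and the Poisson integral of f has no usable variance.
    Cutting f at the fixed level 1 gives h^2 <= h / t for h = min(f, 1) / t, hence convergence of
    that part in L^2; a bounded moment of order above p then turns this into L^p, also when p > 2.
    The moment bound needs no formula for integer moments: the Mecke identity expresses a moment of
    order q + 1 through moments of order q of shifted sums, and these are absorbed into the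
    left-hand side. The identity with general phi is proved for simple integrands only, where it
    comes from independence and the recursion (k + 1) P(k + 1) = c P(k). For other integrands only
    upper bounds on moments are used, and Fatou's lemma carries them over; the mean alone is needed
    exactly, and monotone convergence gives it. All errors are measured by one parameter theta <= 1
    that dominates both 1 / t and (1 / t) int f^p dnu. For the heat kernel it is a constant times
    t^(-d (p - 1) / 2). *)

Section countable_partition.
Context d (T : measurableType d) (R : realType) (mu : {measure set T -> \bar R}).
Local Open Scope ereal_scope.

Lemma ge0_integral_countable_partition (I : countType) (E : I -> set T)
    (F : I -> \bar R) (G : T -> \bar R) :
  (forall i, measurable (E i)) -> trivIset setT E ->
  {ae mu, forall x, (\bigcup_i E i) x} ->
  (forall i, 0 <= F i) -> (forall x, 0 <= G x) -> measurable_fun setT G ->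
  (forall i x, E i x -> G x = F i) ->
  \int[mu]_x G x = \esum_(i in setT) (F i * mu (E i)).
Proof.
move=> mE tE aeE F0 G0 mG GF.
pose E' k := if pickle_inv k is Some i then E i else set0 : set T.
pose a k := if pickle_inv k is Some i then F i * mu (E i) else 0.
have a0 k : 0 <= a k by rewrite /a; case: pickle_inv => // i; rewrite mule_ge0.
have mE' k : measurable (E' k) by rewrite /E'; case: pickle_inv.
have tE' : trivIset setT E'.
  move=> k l _ _ [x []]; rewrite /E'.
  case Ek: (pickle_inv k) => [i|]//; case El: (pickle_inv l) => [j|]// Eix Ejx.
  have ij : i = j by apply: tE => //; exists x.
  have := @pickle_invK I k; have := @pickle_invK I l.
  by rewrite /oapp Ek El ij => <- <-.
have UE : \bigcup_i E i = \bigcup_k E' k.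
  apply/seteqP; split => x [i _ Eix].
    by exists (pickle i) => //; rewrite /E' pickleK_inv.
  by move: Eix; rewrite /E'; case: pickle_inv => // j; exists j.
have mU : measurable (\bigcup_k E' k) by exact: bigcupT_measurable.
have -> : \int[mu]_x G x = \int[mu]_(x in \bigcup_k E' k) G x.
  rewrite [RHS]integral_mkcond; apply: ge0_ae_eq_integral => //.
  - by apply/(measurable_restrictT _ mU)/measurable_funTS.
  - by move=> x _; rewrite patchE; case: ifP.
  - rewrite -UE; apply: filterS aeE => x Ux _.
    by rewrite patchE ifT// inE.
rewrite ge0_integral_bigcup//; last exact: measurable_funTS.
rewrite (eq_eseriesr (g := a)); last first.
  move=> k _; rewrite /a; case Ek : (pickle_inv k) => [i|]; last first.
    by rewrite /E' Ek integral_set0.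
  have -> : E' k = E i by rewrite /E' Ek.
  rewrite (eq_integral (cst (F i))) ?integral_cst//.
  by move=> x; rewrite inE => /GF.
rewrite nneseries_esumT//.
transitivity (\esum_(k in range (@pickle I)) a k).
  rewrite [RHS]esum_mkcond; apply: eq_esum => k _.
  case: ifPn => //; rewrite notin_setE /a => kI.
  case Ek : (pickle_inv k) => [i|]//; exfalso; apply: kI; exists i => //.
  by have := @pickle_invK I k; rewrite Ek.
rewrite esum_image; last by move=> i j _ _; exact: (pcan_inj (@pickleK_inv I)).
by apply: eq_esum => i _; rewrite /a pickleK_inv.
Qed.
End countable_partition.

(** For a rate that is not positive the law is the Dirac mass at 0; rate 0 does occur, for sets of
    intensity zero. *)
Lemma poisson_prob_set1 (R : realType) (c : R) k :
  poisson_prob c 0%N [set k] =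
  if 0 < c then (poisson_pmf c k)%:E else (\d_0%N [set k])%E.
Proof.
by rewrite /poisson_prob; case: ifPn => // c0; rewrite esum_set1 ?lee_fin ?poisson_pmf_ge0.
Qed.

(** The source of the Mecke identity: a factor counting points is traded for a unit shift of the
    count. For [c = 0] both sides vanish. *)
Lemma poisson_prob_succ (R : realType) (c : R) k : 0 <= c ->
  (k.+1%:R%:E * poisson_prob c 0%N [set k.+1] =
   c%:E * poisson_prob c 0%N [set k])%E.
Proof.
rewrite le_eqVlt => /predU1P[<-|c0]; rewrite !poisson_prob_set1.
  by rewrite ltxx mul0e diracE memNset ?mule0//= => /eqP.
rewrite c0 -!EFinM /poisson_pmf c0 factS natrM exprS; congr EFin.
by field; rewrite pnatr_eq0 -lt0n fact_gt0 nat1r pnatr_eq0.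
Qed.

Section poisson_vector.
Context dO (Omega : measurableType dO) (R : realType) (P : probability Omega R).
Context n (N : 'I_n -> Omega -> \bar R) (c : 'I_n -> R).
Hypothesis mN : forall i, measurable_fun setT (N i).
Hypothesis c0 : forall i, 0 <= c i.
Hypothesis lawN : forall i k,
  P [set w | N i w = k%:R%:E] = poisson_prob (c i) 0%N [set k].
Hypothesis indepN : independent_family P N.
Local Open Scope ereal_scope.

Local Notation count_vector := {ffun 'I_n -> nat}.

Let level (v : count_vector) := [set w | forall i, N i w = (v i)%:R%:E].

Let measurable_level1 i k : measurable [set w | N i w = k%:R%:E].
Proof.
rewrite (_ : [set _ | _] = N i @^-1` [set k%:R%:E])//.
by rewrite -[X in measurable X]setTI; apply: mN => //; exact: emeasurable_set1.
Qed.

Let measurable_level v : measurable (level v).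
Proof.
rewrite (_ : level v = \bigcap_(i in [set: 'I_n]) [set w | N i w = (v i)%:R%:E]).
  by apply: fin_bigcap_measurable.
by apply/seteqP; split => [w vw i _|w vw i]; [exact: vw|exact: (vw i)].
Qed.

Let trivIset_level : trivIset setT level.
Proof.
move=> u v _ _ [w [uw vw]]; apply/ffunP => i.
by have := vw i; rewrite uw => -[/eqP]; rewrite eqr_nat => /eqP.
Qed.

Let prob_level v : P (level v) = \prod_(i < n) poisson_prob (c i) 0%N [set v i].
Proof.
rewrite (indepN (B := fun i => [set (v i)%:R%:E])); last first.
  by move=> i; exact: emeasurable_set1.
by apply: eq_bigr => i _; exact: lawN.
Qed.

(** Counts take values in [\bar R], but the Poisson masses sum to 1, so almost surely every count is
    a natural number. *)
Let ae_level : {ae P, forall w, (\bigcup_v level v) w}.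
Proof.
have ae1 i : {ae P, forall w, exists k, N i w = k%:R%:E}.
  pose U := \bigcup_k [set w | N i w = k%:R%:E].
  have mU : measurable U by exact: bigcupT_measurable.
  have PU : P U = 1.
    rewrite measure_bigcup//; last first.
      move=> k l _ _ [w /= [-> [/eqP]]]; by rewrite eqr_nat => /eqP.
    rewrite -(@probability_setT _ _ _ (poisson_prob (c i) 0%N)).
    rewrite -[X in _ = poisson_prob _ _ X](_ : \bigcup_(k in setT) [set k] = setT :> set nat).
      rewrite measure_bigcup//.
        by apply: eq_eseriesr => k _; exact: lawN.
      by move=> k l _ _ [x [/= -> ->]].
    by apply/seteqP; split => // k _; exists k.
  exists (~` U); split; first exact: measurableC.
  - by rewrite probability_setC// PU subee.
  - by move=> w /= + [k _ /= Uw]; apply; exists k.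
have := @filter_forall _ _ _ _ (ae_filter_ringOfSetsType P) ae1; apply: filterS => w /choice[f fw].
by exists [ffun i => f i] => // i /=; rewrite ffunE.
Qed.

Lemma ge0_expectation_poisson_vector (F : count_vector -> \bar R)
    (G : Omega -> \bar R) :
  (forall v, 0 <= F v) -> (forall w, 0 <= G w) -> measurable_fun setT G ->
  (forall (v : count_vector) w, (forall i, N i w = (v i)%:R%:E) -> G w = F v) ->
  \int[P]_w G w =
  \esum_(v in setT) (F v * \prod_(i < n) poisson_prob (c i) 0%N [set v i]).
Proof.
move=> F0 G0 mG GF; under eq_esum do rewrite -prob_level.
by apply: ge0_integral_countable_partition => // v w; exact: GF.
Qed.

Let shift i (v : count_vector) : count_vector :=
  [ffun j => (v j + (j == i))%N].

(** In the sum over count vectors, the recursion for the [i]-th Poisson factor absorbs the weight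
    [v i]. [G] and [H] are prescribed only where all counts are natural numbers, which leaves
    callers free to use [fine] elsewhere. *)
Lemma poisson_vector_mecke i (F : count_vector -> \bar R)
    (G H : Omega -> \bar R) :
  (forall v, 0 <= F v) ->
  (forall w, 0 <= G w) -> measurable_fun setT G ->
  (forall w, 0 <= H w) -> measurable_fun setT H ->
  (forall (v : count_vector) w, (forall j, N j w = (v j)%:R%:E) -> G w = (v i)%:R%:E * F v) ->
  (forall (v : count_vector) w, (forall j, N j w = (v j)%:R%:E) ->
    H w = F [ffun j => (v j + (j == i))%N]) ->
  \int[P]_w G w = (c i)%:E * \int[P]_w H w.
Proof.
move=> F0 G0 mG H0 mH GF HF.
rewrite -ge0_integralZl ?lee_fin//.
rewrite (ge0_expectation_poisson_vector _ G0 mG GF); last first.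
  by move=> v; rewrite mule_ge0 ?lee_fin.
have cH0 w : 0 <= (c i)%:E * H w by rewrite mule_ge0 ?lee_fin.
have cHF (v : count_vector) w : (forall j, N j w = (v j)%:R%:E) ->
    (c i)%:E * H w = (c i)%:E * F (shift i v) by move=> /HF ->.
rewrite (ge0_expectation_poisson_vector _ cH0 _ cHF); last 2 first.
- by move=> v; rewrite mule_ge0 ?lee_fin.
- exact: measurable_funeM.
have prod0 v : 0 <= \prod_(j < n) poisson_prob (c j) 0%N [set v j].
  by apply: prode_ge0 => j _.
(* Vectors with [v i = 0] contribute nothing; the others are exactly the images of all vectors under
   [shift i]. *)
rewrite (esumID [set v : count_vector | (0 < v i)%N]); last first.
  by move=> v _; rewrite !mule_ge0 ?lee_fin.
rewrite [X in _ + X]esum1 ?adde0; last first.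
  by move=> v [_ /= /negP]; rewrite -leqNgt leqn0 => /eqP ->; rewrite !mul0e.
rewrite setTI (@reindex_esum _ _ _ setT _ (shift i)); last first.
  split.
  - by move=> v _ /=; rewrite ffunE eqxx addn1.
  - move=> u v _ _ /ffunP uv; apply/ffunP => j; have := uv j.
    by rewrite !ffunE => /addIn.
  - move=> v /= vi; exists [ffun j => (v j - (j == i))%N] => //.
    apply/ffunP => j; rewrite !ffunE subnK//.
    by case: eqP => // ->.
apply: eq_esum => v _; rewrite {1}/shift ffunE eqxx addn1.
rewrite [(_ * F _)%E]muleC [((c i)%:E * _)%E]muleC -!muleA; congr *%E.
rewrite (bigD1 i)//= [in RHS](bigD1 i)//= !muleA ffunE eqxx addn1.
rewrite poisson_prob_succ//; congr *%E.
by apply: eq_bigr => j /negbTE ji; rewrite ffunE ji addn0.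
Qed.

End poisson_vector.

Section simple_functions.
Context d (T : measurableType d) (R : realType).
Import HBNNSimple.

(** The level set of the value 0 is left out because it may have infinite measure; this is why
    [phi 0 = 0] is required. *)
Lemma nnsfun_level_sets (s : {nnsfun T >-> R}) :
  exists n (a : 'I_n -> R) (A : 'I_n -> set T),
  [/\ forall i, 0 < a i, forall i, measurable (A i), trivIset setT A &
    forall (phi : R -> R) x, phi 0 = 0 ->
      phi (s x) = \sum_(i < n) phi (a i) * \1_(A i) x].
Proof.
pose D := range s `&` [set r | 0 < r].
have fD : finite_set D by apply: finite_setIl; exact: fimfunP.
have [r0 Dr0] := (finite_seqP D).1 fD; pose r := undup r0.
have ur : uniq r by exact: undup_uniq.
have rD x : (x \in r) = (x \in D).
  by rewrite mem_undup Dr0; apply/idP/idP; rewrite inE.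
pose a (i : 'I_(size r)) := r`_i.
pose A (i : 'I_(size r)) := s @^-1` [set a i].
exists (size r), a, A; split.
- move=> i; have : a i \in D by rewrite -rD mem_nth.
  by rewrite inE => -[].
- by move=> i; exact: measurable_sfunP.
- move=> i j _ _ [x [/= sxi sxj]]; apply: val_inj; apply/eqP.
  by rewrite -(nth_uniq 0 (ltn_ord i) (ltn_ord j) ur) -[r`_i]sxi -[r`_j]sxj.
- move=> phi x phi0; have [sx0|] := eqVneq (s x) 0.
    rewrite sx0 phi0 big1// => i _; rewrite indicE memNset ?mulr0//= /A/= sx0 => a0.
    have : a i \in D by rewrite -rD mem_nth.
    by rewrite -a0 inE => -[_ /=]; rewrite ltxx.
  move=> sx0; have sxr : s x \in r.
    by rewrite rD inE; split; [exists x|rewrite /= lt0r sx0 fun_ge0].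
  have ltr : (index (s x) r < size r)%N by rewrite index_mem.
  have aj : a (Ordinal ltr) = s x by rewrite /a /= nth_index.
  rewrite (bigD1 (Ordinal ltr))//= big1 ?addr0.
    by rewrite aj indicE mem_set ?mulr1//= /A/= aj.
  move=> i ij; rewrite indicE memNset ?mulr0//= /A /= => sxa.
  move/eqP: ij; apply; apply: val_inj => /=.
  by rewrite sxa /a index_uniq.
Qed.

Lemma ge0_integral_sum_indic (mu : {measure set T -> \bar R}) n (b : 'I_n -> R)
    (A : 'I_n -> set T) :
  (forall i, 0 <= b i) -> (forall i, measurable (A i)) ->
  (\int[mu]_x (\sum_(i < n) b i * \1_(A i) x)%:E =
   \sum_(i < n) (b i)%:E * mu (A i))%E.
Proof.
move=> b0 mA.
under eq_integral do rewrite -sumEFin.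
rewrite ge0_integral_sum//.
- apply: eq_bigr => i _; under eq_integral do rewrite EFinM.
  rewrite ge0_integralZl_EFin//.
  + by rewrite integral_indic// setIT.
  + by apply/measurable_EFinP; exact: measurable_indic.
- move=> i; apply/measurable_EFinP; apply: measurable_funM => //.
- by move=> i x _; rewrite lee_fin mulr_ge0.
Qed.

End simple_functions.

Section mecke.
Context dO dE (Omega : measurableType dO) (E : measurableType dE)
  (R : realType) (P : probability Omega R).
Variables (N : Omega -> {measure set E -> \bar R}) (nu : {measure set E -> \bar R}).
Hypothesis hN : is_poisson_random_measure P N nu.

(** The Mecke identity for a single count and the constant function 1. *)
Lemma expectation_poisson_random_measure A : measurable A -> (nu A < +oo)%E ->
  (\int[P]_w N w A = nu A)%E.
Proof.
move=> mA Aoo; have fA : nu A \is a fin_num by rewrite ge0_fin_numE.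
have mNA : 'I_1 -> measurable_fun setT (fun w => N w A).
  by move=> _; exact: (prm_measurable hN).
rewrite (@poisson_vector_mecke _ _ _ P 1 (fun=> fun w => N w A) (fun=> fine (nu A))
  mNA _ _ _ ord0 (cst 1%E) (fun w => N w A) (cst 1%E))//.
- rewrite integral_cst// mul1e fineK// -[RHS]mule1; congr (_ * _)%E.
  exact: probability_setT.
- by move=> _ k; exact: (prm_poisson hN).
- apply: (prm_independent hN (A := fun=> A)) => //.
  by move=> i j _ _ _; rewrite (ord1 i) (ord1 j).
- exact: mNA ord0.
- by move=> v w /(_ ord0) ->; rewrite mule1.
Qed.

Context n (a : 'I_n -> R) (A : 'I_n -> set E).
Hypothesis a0 : forall i, 0 <= a i.
Hypothesis mA : forall i, measurable (A i).
Hypothesis tA : trivIset setT A.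
Hypothesis Aoo : forall i, (nu (A i) < +oo)%E.

Definition poisson_sum (w : Omega) : R := \sum_(i < n) a i * fine (N w (A i)).

Lemma poisson_sum_ge0 w : 0 <= poisson_sum w.
Proof. by apply: sumr_ge0 => i _; rewrite mulr_ge0// fine_ge0. Qed.

Lemma measurable_poisson_sum : measurable_fun setT poisson_sum.
Proof.
apply: measurable_sum => i; apply: measurable_funM => //.
by apply: measurableT_comp => //; exact: (prm_measurable hN).
Qed.

(** The first factor is expanded by linearity; one more point in [A i] moves the sum by [a i], so
    the identity for counts applies to each term. *)
Lemma poisson_sum_mecke (phi : R -> R) :
  (forall x, 0 <= phi x) -> measurable_fun setT phi ->
  (\int[P]_w (poisson_sum w * phi (poisson_sum w))%:E =
   \sum_(i < n) (a i * fine (nu (A i)))%:E *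
     \int[P]_w (phi (poisson_sum w + a i))%:E)%E.
Proof.
move=> phi0 mphi.
have mX := measurable_poisson_sum.
have mN i : measurable_fun setT (fun w => fine (N w (A i))).
  by apply: measurableT_comp => //; exact: (prm_measurable hN).
have mphiX : measurable_fun setT (phi \o poisson_sum) by exact: measurableT_comp.
transitivity (\sum_(i < n) (a i)%:E *
    \int[P]_w (fine (N w (A i)) * phi (poisson_sum w))%:E)%E.
  under eq_integral do rewrite mulr_suml -sumEFin.
  rewrite ge0_integral_sum//.
  - apply: eq_bigr => i _; under eq_integral do rewrite -mulrA EFinM.
    rewrite ge0_integralZl_EFin//.
    + by move=> w _; rewrite lee_fin mulr_ge0// fine_ge0.
    + by apply/measurable_EFinP; exact: measurable_funM.
  - move=> i; apply/measurable_EFinP; apply: measurable_funM => //.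
    exact: measurable_funM.
  - by move=> i w _; rewrite lee_fin !mulr_ge0// fine_ge0.
apply: eq_bigr => i _; rewrite EFinM -muleA; congr (_ * _)%E.
apply: (@poisson_vector_mecke _ _ _ P n (fun i w => N w (A i))
  (fun i => fine (nu (A i))) _ _ _ _ i
  (fun v => (phi (\sum_(j < n) a j * (v j)%:R))%:E)) => //.
- by move=> j; exact: (prm_measurable hN).
- by move=> j k; exact: (prm_poisson hN).
- exact: (prm_independent hN).
- by move=> v; rewrite lee_fin.
- by move=> w; rewrite lee_fin mulr_ge0// fine_ge0.
- by apply/measurable_EFinP; exact: measurable_funM.
- by move=> w; rewrite lee_fin.
- apply/measurable_EFinP; apply: (measurableT_comp mphi).
  exact: measurable_funD.
- move=> v w vw; rewrite vw -EFinM; congr (_ * phi _)%:E.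
  by apply: eq_bigr => j _; rewrite vw.
- move=> v w vw; congr (phi _)%:E; rewrite /poisson_sum.
  rewrite (bigD1 i)//= [in RHS](bigD1 i)//= !ffunE eqxx vw/= natrD mulrDr mulr1.
  rewrite addrAC; congr (_ + _).
  by apply: eq_bigr => j /negbTE ji; rewrite ffunE ji addn0 vw.
Qed.

End mecke.

(** * Moments from the Mecke identity *)

Section fatou.
Context d (T : measurableType d) (R : realType) (mu : {measure set T -> \bar R}).

(** No convergence is asked where [f] vanishes. This covers Poisson integrals, which are set to 0
    where they diverge although their approximations do not tend to 0 there. *)
Lemma fatou_bound (f : T -> R) (g : nat -> T -> R) (C : \bar R) :
  measurable_fun setT f -> (forall x, 0 <= f x) ->
  (forall n, measurable_fun setT (g n)) -> (forall n x, 0 <= g n x) ->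
  (forall x, f x = 0 \/ g n x @[n --> \oo] --> f x) ->
  (forall n, \int[mu]_x (g n x)%:E <= C)%E -> (\int[mu]_x (f x)%:E <= C)%E.
Proof.
move=> mf f0 mg g0 gf gC.
have mg' n : measurable_fun setT (fun x => (g n x)%:E) by exact/measurable_EFinP.
have g0' n x : setT x -> (0 <= (g n x)%:E)%E by move=> _; rewrite lee_fin.
apply: (@le_trans _ _ (\int[mu]_x limn_einf (fun n => (g n x)%:E))%E).
  apply: ge0_le_integral => //.
  - by move=> x _; rewrite lee_fin.
  - exact/measurable_EFinP.
  - apply: (emeasurable_fun_cvg (fun k x => einfs (fun n => (g n x)%:E) k)).
      by move=> k; exact: measurable_fun_einfs.
    by move=> x _; rewrite limn_einf_lim; exact: is_cvg_einfs.
  move=> x _; case: (gf x) => [->|gfx].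
    rewrite limn_einf_lim; apply: lime_ge; first exact: is_cvg_einfs.
    apply: nearW => n; apply: le_ereal_inf_tmp => _ [k _ <-].
    by rewrite lee_fin.
  have gfx' : (g n x)%:E @[n --> \oo] --> (f x)%:E.
    by apply/fine_cvgP; split => //; exact: nearW.
  by have [-> _] := cvg_limn_einf_sup gfx'.
apply: le_trans (fatou mu measurableT mg' g0') _.
rewrite limn_einf_lim; apply: lime_le; first exact: is_cvg_einfs.
apply: nearW => n; apply: le_trans (gC n).
by apply: ereal_inf_lbound; exists n => /=.
Qed.

End fatou.

Section powR_inequalities.
Context {R : realType}.
Implicit Types (x y a q L : R).

Lemma powR_sum_le2 x y q : 0 <= x -> 0 <= y -> 0 <= q ->
  (x + y) `^ q <= 2 `^ q * (x `^ q + y `^ q).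
Proof.
wlog xy : x y / x <= y => [hw x0 y0 q0|x0 y0 q0].
  case: (leP x y) => [|/ltW] xy; first exact: hw.
  by rewrite addrC [_ `^ _ + _]addrC; exact: hw.
apply: (@le_trans _ _ ((2 * y) `^ q)).
  by apply: ge0_ler_powR; rewrite ?nnegrE//; lra.
rewrite powRM ?ler_wpM2l ?powR_ge0//.
by rewrite lerDr powR_ge0.
Qed.

Lemma powRD1 x q : 0 <= x -> 0 < q -> x `^ (q + 1) = x `^ q * x.
Proof.
move=> x0 q0; rewrite powRD ?powRr1//; apply/implyP.
by rewrite gt_eqF// addr_gt0.
Qed.

Lemma powR_min_add_le x a q L : 0 <= x -> 0 <= a -> 0 <= q -> 0 <= L ->
  (Num.min (x + a) L) `^ q <= 2 `^ q * ((Num.min x L) `^ q + a `^ q).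
Proof.
move=> x0 a0 q0 L0; apply: le_trans (powR_sum_le2 _ _ _) => //; last first.
  by rewrite le_min x0.
apply: ge0_ler_powR; rewrite ?nnegrE// ?le_min ?addr_ge0//.
  by rewrite le_min x0.
by rewrite minElt [Num.min x L]minElt; case: ifPn; case: ifPn; lra.
Qed.

(** Cut at x = 1 / e: below it the last term suffices, above it 1 <= e x. A moment of order q is
    thus bounded by a small multiple of the one of order q + 1. *)
Lemma powR_min_le_absorb x q L e : 0 <= x -> 0 <= q -> 0 <= L -> 0 < e ->
  (Num.min x L) `^ q <= e * (x * (Num.min x L) `^ q) + e^-1 `^ q.
Proof.
move=> x0 q0 L0 e0; have m0 : 0 <= Num.min x L by rewrite le_min x0.
have p0 := powR_ge0 (Num.min x L) q; have p0' := powR_ge0 e^-1 q.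
case: (leP (e * x) 1) => ex.
  apply: ler_wpDl; first by rewrite !mulr_ge0// ltW.
  apply: ge0_ler_powR; rewrite ?nnegrE ?invr_ge0 ?(ltW e0)//.
  by rewrite ge_min -(ler_pM2l e0) mulfV ?ex// gt_eqF.
by rewrite mulrA; nra.
Qed.

(** The choice of [e] makes the coefficient of [m] on the right at most 1/2, so that term moves to
    the left. Here [t] stands for 2^q, [m] for the truncated moment and [u] for e^(-q). *)
Lemma absorb_le (t b B e m u A : R) : 0 < t -> 0 <= b -> b <= B -> 0 <= e ->
  2 * (t * (B * e)) = 1 -> 0 <= m -> 0 <= u -> 0 <= A ->
  m <= t * (b * (e * m + u) + A) -> m <= 2 * t * (1 + u) * (b + A).
Proof.
move=> t0 b0 bB e0 eE m0 u0 A0 mle.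
have h1 : t * (b * (e * m)) <= t * (B * (e * m)).
  by rewrite ler_wpM2l ?(ltW t0)// ler_wpM2r// mulr_ge0.
have h2 : 2 * (t * (B * (e * m))) = m.
  transitivity (2 * (t * (B * e)) * m); first by ring.
  by rewrite eE mul1r.
have h3 : m <= 2 * t * (b * u + A) by lra.
apply: (le_trans h3); rewrite -!mulrA ler_wpM2l// ler_wpM2l ?(ltW t0)//.
have := mulr_ge0 u0 A0; have := mulr_ge0 b0 u0; nra.
Qed.

End powR_inequalities.

Lemma integral_probability_cst d (T : measurableType d) (R : realType)
  (P : probability T R) (r : R) : (\int[P]_w r%:E = r%:E)%E.
Proof.
by rewrite integral_cst// -[RHS]mule1; congr (_ * _)%E; exact: probability_setT.
Qed.

Section mecke_moments.
Context d (Omega : measurableType d) (R : realType) (P : probability Omega R).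
Context n (a c : 'I_n -> R) (X : Omega -> R).
Hypothesis a0 : forall i, 0 <= a i.
Hypothesis c0 : forall i, 0 <= c i.
Hypothesis mX : measurable_fun setT X.
Hypothesis X0 : forall w, 0 <= X w.
Hypothesis mecke : forall phi : R -> R,
  (forall x, 0 <= phi x) -> measurable_fun setT phi ->
  (\int[P]_w (X w * phi (X w))%:E =
   \sum_(i < n) (a i * c i)%:E * \int[P]_w (phi (X w + a i))%:E)%E.

Let b := \sum_(i < n) a i * c i.

Let b_ge0 : 0 <= b.
Proof. by apply: sumr_ge0 => i _; rewrite mulr_ge0. Qed.

Lemma mecke_mean : (\int[P]_w (X w)%:E = b%:E)%E.
Proof.
transitivity (\int[P]_w (X w * 1)%:E)%E; first by under [RHS]eq_integral do rewrite mulr1.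
rewrite (mecke (phi := cst 1))//.
under eq_bigr do rewrite /= integral_probability_cst mule1.
by rewrite sumEFin.
Qed.

Lemma mecke_second_moment :
  (\int[P]_w (X w ^+ 2)%:E = (b ^+ 2 + \sum_(i < n) a i ^+ 2 * c i)%:E)%E.
Proof.
(* [phi] must be nonnegative on the whole line, hence the absolute value in place of the
   identity. *)
transitivity (\int[P]_w (X w * `|X w|)%:E)%E.
  by apply: eq_integral => w _; rewrite ger0_norm.
rewrite (mecke (phi := Num.norm))//.
transitivity (\sum_(i < n) (a i * c i * (b + a i))%:E)%E.
  apply: eq_bigr => i _; rewrite [RHS]EFinM; congr (_ * _)%E.
  under eq_integral do rewrite ger0_norm ?addr_ge0// EFinD.
  rewrite ge0_integralD//.
  - by rewrite mecke_mean integral_probability_cst.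
  - by move=> w _; rewrite lee_fin.
  - exact/measurable_EFinP.
  - by move=> w _; rewrite lee_fin.
rewrite sumEFin; congr EFin.
under eq_bigr do rewrite mulrDr.
rewrite big_split/= -mulr_suml -expr2; congr (_ + _).
by apply: eq_bigr => i _; ring.
Qed.

Let truncated_moment q B (k : nat) : 0 < q -> 0 < B -> b <= B ->
  (\int[P]_w (X w * (Num.min (X w) k%:R) `^ q)%:E <=
  (2 * 2 `^ q * (1 + (2 * 2 `^ q * B) `^ q) *
     (b + \sum_(i < n) a i `^ (q + 1) * c i))%:E)%E.
Proof.
move=> q0 B0 bB.
have q0' := ltW q0.
pose phi (x : R) := (Num.min x k%:R) `^ q.
have mphi : measurable_fun setT phi.
  by apply: (@measurableT_comp _ _ _ _ _ _ (@powR R ^~ q)) => //; exact: measurable_minr.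
have phi0 x : 0 <= phi x by exact: powR_ge0.
have mphiX : measurable_fun setT (phi \o X) by exact: measurableT_comp.
pose M := (\int[P]_w (X w * phi (X w))%:E)%E; rewrite -[X in (X <= _)%E]/M.
have M0 : (0 <= M)%E by apply: integral_ge0 => w _; rewrite lee_fin mulr_ge0.
(* Absorption is legitimate only for a finite quantity; the truncation gives M <= k^q E[X]. *)
have Mfin : M \is a fin_num.
  rewrite ge0_fin_numE//.
  apply: (@le_lt_trans _ _ (\int[P]_w (k%:R `^ q * X w)%:E)%E).
    apply: ge0_le_integral => //.
    - by move=> w _; rewrite lee_fin mulr_ge0.
    - by apply/measurable_EFinP; exact: measurable_funM.
    - by apply/measurable_EFinP; exact: measurable_funM.
    - move=> w _; rewrite lee_fin mulrC ler_wpM2r//.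
      by apply: ge0_ler_powR; rewrite ?nnegrE ?le_min ?X0 ?ler0n// ge_min lexx orbT.
  under eq_integral do rewrite EFinM.
  rewrite ge0_integralZl_EFin ?powR_ge0// ?mecke_mean -?EFinM ?ltry//.
  - by move=> w _; rewrite lee_fin.
  - exact/measurable_EFinP.
(* Chosen so that 2^q B e = 1/2, as [absorb_le] asks. *)
pose e := (2 * 2 `^ q * B)^-1.
have two0 : 0 < 2 `^ q :> R by rewrite powR_gt0.
have e0 : 0 < e by rewrite invr_gt0 !mulr_gt0.
have phiM : (\int[P]_w (phi (X w))%:E <= (e * fine M + e^-1 `^ q)%:E)%E.
  apply: (@le_trans _ _ (\int[P]_w (e%:E * (X w * phi (X w))%:E + (e^-1 `^ q)%:E))%E).
    apply: ge0_le_integral => //.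
    - by move=> w _; rewrite lee_fin.
    - exact/measurable_EFinP.
    - apply: emeasurable_funD => //; apply: measurable_funeM.
      by apply/measurable_EFinP; exact: measurable_funM.
    - move=> w _; rewrite -EFinM -EFinD lee_fin.
      by apply: powR_min_le_absorb.
  rewrite ge0_integralD//.
  - rewrite ge0_integralZl_EFin ?(ltW e0)//.
    + by rewrite integral_probability_cst EFinD EFinM fineK.
    + by move=> w _; rewrite lee_fin mulr_ge0.
    + by apply/measurable_EFinP; exact: measurable_funM.
  - by move=> w _; rewrite mule_ge0 ?lee_fin ?mulr_ge0// ltW.
  - apply: measurable_funeM; apply/measurable_EFinP; exact: measurable_funM.
  - by move=> w _; rewrite lee_fin powR_ge0.
pose A := \sum_(i < n) a i `^ (q + 1) * c i.
(* After the Mecke identity, [powR_min_add_le] separates [a i] from [X], and [phiM] brings back [M]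
   with the small factor [e]. *)
have MM : (M <= (2 `^ q * (b * (e * fine M + e^-1 `^ q) + A))%:E)%E.
  rewrite [X in (X <= _)%E](mecke phi0 mphi).
  apply: (@le_trans _ _ (\sum_(i < n)
     (2 `^ q * (a i * c i * (e * fine M + e^-1 `^ q) + a i `^ (q + 1) * c i))%:E)%E).
    apply: lee_sum => i _.
    apply: (@le_trans _ _ ((a i * c i)%:E *
        (2 `^ q * ((e * fine M + e^-1 `^ q) + a i `^ q))%:E)%E).
      apply: lee_wpmul2l; first by rewrite lee_fin mulr_ge0.
      apply: (@le_trans _ _ (\int[P]_w ((2 `^ q)%:E * ((phi (X w))%:E + (a i `^ q)%:E)))%E).
        apply: ge0_le_integral => //.
        - by move=> w _; rewrite lee_fin.
        - apply/measurable_EFinP; apply: (measurableT_comp mphi).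
          exact: measurable_funD.
        - apply: measurable_funeM; apply: emeasurable_funD => //.
          exact/measurable_EFinP.
        - move=> w _; rewrite -EFinD -EFinM lee_fin.
          exact: powR_min_add_le.
      rewrite ge0_integralZl_EFin ?powR_ge0//.
      - rewrite EFinM lee_pmul2l ?lte_fin//.
        rewrite ge0_integralD//.
        + by rewrite integral_probability_cst EFinD leeD2r.
        + by move=> w _; rewrite lee_fin.
        + exact/measurable_EFinP.
        + by move=> w _; rewrite lee_fin powR_ge0.
      - by move=> w _; rewrite adde_ge0 ?lee_fin ?powR_ge0.
      - by apply: emeasurable_funD => //; exact/measurable_EFinP.
    rewrite -EFinM lee_fin powRD1// le_eqVlt; apply/orP; left; apply/eqP; ring.
  rewrite sumEFin lee_fin -mulr_sumr big_split/= -mulr_suml.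
  exact: lexx.
rewrite -(fineK Mfin) !lee_fin in MM *.
have A0 : 0 <= A by apply: sumr_ge0 => i _; rewrite mulr_ge0 ?powR_ge0.
have E0 := powR_ge0 e^-1 q.
have eE : 2 * (2 `^ q * (B * e)) = 1 by rewrite /e; field; rewrite !gt_eqF.
have M0' : 0 <= fine M by rewrite fine_ge0.
have -> : (2 * 2 `^ q * B) = e^-1 by rewrite /e invrK.
rewrite -/A; apply: (absorb_le two0 b_ge0 bB _ eE) => //; exact: ltW.
Qed.

(* Since E[X^(q+1)] = sum_i a_i c_i E[(X + a_i)^q], the moment of order q + 1 is
   controlled by that of order q, which is in turn absorbed on the left-hand
   side; truncating the power makes the absorbed quantity finite. *)
Lemma mecke_moment q B : 0 < q -> 0 < B -> b <= B ->
  (\int[P]_w (X w `^ (q + 1))%:E <=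
  (2 * 2 `^ q * (1 + (2 * 2 `^ q * B) `^ q) *
     (b + \sum_(i < n) a i `^ (q + 1) * c i))%:E)%E.
Proof.
move=> q0 B0 bB.
apply: (@fatou_bound _ _ _ P _ (fun k w => X w * (Num.min (X w) k%:R) `^ q)).
- by apply: (@measurableT_comp _ _ _ _ _ _ (@powR R ^~ (q + 1))).
- by move=> w; exact: powR_ge0.
- move=> k; apply: measurable_funM => //.
  by apply: (@measurableT_comp _ _ _ _ _ _ (@powR R ^~ q)) => //; exact: measurable_minr.
- by move=> k w; rewrite mulr_ge0 ?powR_ge0.
- move=> w; right; apply: cvg_near_cst; near=> k.
  rewrite powRD1// mulrC min_l//; near: k; exact: nbhs_infty_ger.
- by move=> k; exact: truncated_moment.
Unshelve. all: by end_near. Qed.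

End mecke_moments.

Lemma cvg_powR_gt0 (R : realType) (u : nat -> R) (l q : R) : 0 < l ->
  u n @[n --> \oo] --> l -> (u n `^ q) @[n --> \oo] --> l `^ q.
Proof.
move=> l0 ul; have h : {for l, continuous (@powR R ^~ q)}.
  apply/differentiable_continuous/derivable1_diffP.
  by apply: derivable_powR; rewrite in_itv/= l0.
exact: (@cvg_comp _ _ _ u (@powR R ^~ q) _ _ _ ul h).
Qed.

(** Equality fails when one term is infinite and another is finite and positive, since [fine] sends
    the whole sum to 0. *)
Lemma ge0_fine_sum_le (R : realType) n (x : 'I_n -> \bar R) :
  (forall i, 0 <= x i)%E -> fine (\sum_(i < n) x i)%E <= \sum_(i < n) fine (x i).
Proof.
move=> x0; have s0 : (0 <= \sum_(i < n) x i)%E by exact: sume_ge0.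
have [fs|] := boolP (\sum_(i < n) x i \is a fin_num)%E.
  move/sum_fin_numP : fs => fs; rewrite sum_fine// => i _.
  by apply: fs => //; exact: mem_index_enum.
rewrite ge0_fin_numE// -leNgt leye_eq => /eqP ->.
by apply: sumr_ge0 => i _; exact: fine_ge0.
Qed.

Lemma ge0_fineMl (R : realType) (a : R) (x : \bar R) : (0 <= x)%E -> 0 <= a ->
  fine (a%:E * x)%E = a * fine x.
Proof.
move=> x0; rewrite le_eqVlt => /predU1P[<-|a0]; first by rewrite mul0e mul0r.
case: x x0 => //= _; first by rewrite gt0_muley ?lte_fin//= mulr0.
Qed.

Section integral_simple.
Context d (T : measurableType d) (R : realType).
Import HBNNSimple.

Lemma ge0_le_integral_EFin (mu : {measure set T -> \bar R}) (f g : T -> R) :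
  measurable_fun setT f -> measurable_fun setT g -> (forall x, 0 <= f x) ->
  (forall x, f x <= g x) -> (\int[mu]_x (f x)%:E <= \int[mu]_x (g x)%:E)%E.
Proof.
move=> mf mg f0 fg; apply: ge0_le_integral => //.
- by move=> x _; rewrite lee_fin.
- exact/measurable_EFinP.
- exact/measurable_EFinP.
- by move=> x _; rewrite lee_fin.
Qed.

Lemma ge0_integralD_EFin (mu : {measure set T -> \bar R}) (f g : T -> R) :
  measurable_fun setT f -> measurable_fun setT g ->
  (forall x, 0 <= f x) -> (forall x, 0 <= g x) ->
  (\int[mu]_x (f x + g x)%:E = \int[mu]_x (f x)%:E + \int[mu]_x (g x)%:E)%E.
Proof.
move=> mf mg f0 g0; rewrite -ge0_integralD//.
- by move=> x _; rewrite lee_fin.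
- exact/measurable_EFinP.
- by move=> x _; rewrite lee_fin.
- exact/measurable_EFinP.
Qed.

Lemma ge0_integralZl_EFin_fun (mu : {measure set T -> \bar R}) (k : R) (f : T -> R) :
  0 <= k -> measurable_fun setT f -> (forall x, 0 <= f x) ->
  (\int[mu]_x (k * f x)%:E = k%:E * \int[mu]_x (f x)%:E)%E.
Proof.
move=> k0 mf f0; rewrite -ge0_integralZl_EFin//.
- by move=> x _; rewrite lee_fin.
- exact/measurable_EFinP.
Qed.

Lemma measurable_fun_powR (f : T -> R) q : measurable_fun setT f ->
  measurable_fun setT (fun x => f x `^ q).
Proof. by move=> mf; apply: (@measurableT_comp _ _ _ _ _ _ (@powR R ^~ q)). Qed.

Lemma nnsfun_approximation (h : T -> R) :
  (forall v, 0 <= h v) -> measurable_fun setT h ->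
  exists s : nat -> {nnsfun T >-> R},
  [/\ forall v, {homo (fun k => (s k v)%:E) : k l / (k <= l)%N >-> (k <= l)%E},
    forall k v, s k v <= h v &
    forall v, (s k v)%:E @[k --> \oo] --> (h v)%:E].
Proof.
move=> h0 mh; have mh' : measurable_fun setT (EFin \o h) by exact/measurable_EFinP.
exists (nnsfun_approx measurableT mh'); split => [v k l kl|k v|v].
- by rewrite lee_fin; apply/lefP; exact: nd_nnsfun_approx.
- rewrite -lee_fin nnsfun_approxE; apply: le_approx => // u _.
  by rewrite lee_fin.
- by apply: cvg_nnsfun_approx => // u _; rewrite lee_fin.
Qed.

(** Integrability for [nu] forces finite [nu (A i)] because the values are positive. The same sets
    serve every measure [mu], so they compute the random integral and its intensity at once. *)
Lemma nnsfun_integral_level_sets (s : {nnsfun T >-> R}) (nu : {measure set T -> \bar R}) :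
  (\int[nu]_x (s x)%:E < +oo)%E ->
  exists n (a : 'I_n -> R) (A : 'I_n -> set T),
  [/\ forall i, 0 <= a i, forall i, measurable (A i), trivIset setT A,
    forall i, (nu (A i) < +oo)%E &
    forall (mu : {measure set T -> \bar R}) (phi : R -> R),
      phi 0 = 0 -> (forall x, 0 <= x -> 0 <= phi x) ->
      (\int[mu]_x (phi (s x))%:E = \sum_(i < n) (phi (a i))%:E * mu (A i))%E].
Proof.
move=> soo; have [n [a [A [a0 mA tA phiE]]]] := nnsfun_level_sets s.
have intE (mu : {measure set T -> \bar R}) (phi : R -> R) :
      phi 0 = 0 -> (forall x, 0 <= x -> 0 <= phi x) ->
      (\int[mu]_x (phi (s x))%:E = \sum_(i < n) (phi (a i))%:E * mu (A i))%E.
  move=> phi0 phi_ge0; rewrite -ge0_integral_sum_indic//.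
    by apply: eq_integral => x _; rewrite phiE.
  by move=> i; rewrite phi_ge0// ltW.
exists n, a, A; split => // [i|i]; first exact: ltW.
rewrite ltey; apply: contraTneq soo => Ai.
rewrite (intE nu id)// (bigD1 i)//= Ai gt0_muley ?lte_fin//.
rewrite addye ?ltxx// -ltNye (lt_le_trans ltNy0)// sume_ge0// => j _.
by rewrite mule_ge0// lee_fin ltW.
Qed.

End integral_simple.

(** * Integrals with respect to a Poisson random measure *)

Section poisson_integral.
Context dO dE (Omega : measurableType dO) (E : measurableType dE)
  (R : realType) (P : probability Omega R).
Variables (N : Omega -> {measure set E -> \bar R}) (nu : {measure set E -> \bar R}).
Hypothesis hN : is_poisson_random_measure P N nu.
Implicit Type h : E -> R.
Import HBNNSimple.

(* Equal to 0 where the integral is infinite. *)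
Definition poisson_integral h (w : Omega) : R := fine (\int[N w]_v (h v)%:E)%E.

Lemma measurable_integral_poisson h : (forall v, 0 <= h v) ->
  measurable_fun setT h -> measurable_fun setT (fun w => \int[N w]_v (h v)%:E)%E.
Proof.
move=> h0 mh; apply: measurable_fun_integral_kernel.
- by move=> U mU; exact: (prm_measurable hN).
- by move=> v; rewrite lee_fin.
- exact/measurable_EFinP.
Qed.

Lemma measurable_poisson_integral h : (forall v, 0 <= h v) ->
  measurable_fun setT h -> measurable_fun setT (poisson_integral h).
Proof.
move=> h0 mh; apply: measurableT_comp => //.
exact: measurable_integral_poisson.
Qed.

Lemma poisson_integral_ge0 h w : (forall v, 0 <= h v) -> 0 <= poisson_integral h w.
Proof.
by move=> h0; apply: fine_ge0; apply: integral_ge0 => v _; rewrite lee_fin.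
Qed.

(** Campbell's formula, by monotone convergence from the expectation of a single count. *)
Lemma integral_poisson_mean h : (forall v, 0 <= h v) -> measurable_fun setT h ->
  (\int[nu]_v (h v)%:E < +oo)%E ->
  (\int[P]_w \int[N w]_v (h v)%:E = \int[nu]_v (h v)%:E)%E.
Proof.
move=> h0 mh hoo.
have [s [nds le_h sh]] := nnsfun_approximation h0 mh.
have s0 k v : (0 <= (s k v)%:E)%E by rewrite lee_fin.
have ms k : measurable_fun setT (EFin \o s k) by exact/measurable_EFinP.
have lims (m : {measure set E -> \bar R}) :
    (\int[m]_v (h v)%:E = limn (fun k => \int[m]_v (s k v)%:E))%E.
  rewrite -monotone_convergence//.
    by apply: eq_integral => v _; apply/esym/cvg_lim => //; exact: sh.
transitivity (\int[P]_w limn (fun k => \int[N w]_v (s k v)%:E))%E.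
  by apply: eq_integral => w _; exact: lims.
rewrite monotone_convergence//; last 3 first.
- by move=> k; exact: measurable_integral_poisson.
- by move=> k w _; exact: integral_ge0.
- move=> w _ k l kl; apply: ge0_le_integral => //; [exact: ms|exact: ms|].
  by move=> v _; exact: nds.
rewrite lims; congr (limn _); apply/funext => k.
have soo : (\int[nu]_v (s k v)%:E < +oo)%E.
  by apply: le_lt_trans (ge0_le_integral_EFin nu _ mh _ (le_h k)) hoo.
have [n [a [A [a0 mA tA Aoo intE]]]] := nnsfun_integral_level_sets soo.
rewrite (intE nu id)//.
rewrite (eq_integral (fun w => \sum_(i < n) (a i)%:E * N w (A i))%E); last first.
  by move=> w _; exact: (intE _ id).
rewrite ge0_integral_sum//.
- apply: eq_bigr => i _; rewrite ge0_integralZl_EFin//.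
  + by rewrite (expectation_poisson_random_measure hN).
  + exact: (prm_measurable hN).
- by move=> i; apply: measurable_funeM; exact: (prm_measurable hN).
- by move=> i w _; rewrite mule_ge0// lee_fin.
Qed.

Lemma poisson_integral_ae_lty h : (forall v, 0 <= h v) -> measurable_fun setT h ->
  (\int[nu]_v (h v)%:E < +oo)%E ->
  {ae P, forall w, (\int[N w]_v (h v)%:E < +oo)%E}.
Proof.
move=> h0 mh hoo.
have J0 w : (0 <= \int[N w]_v (h v)%:E)%E.
  by apply: integral_ge0 => v _; rewrite lee_fin.
have : P.-integrable setT (fun w => \int[N w]_v (h v)%:E)%E.
  apply/integrableP; split; first exact: measurable_integral_poisson.
  by under eq_integral do rewrite gee0_abs//; rewrite integral_poisson_mean.
move=> /integrable_ae => /(_ measurableT); apply: filterS => w /(_ I).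
by rewrite ge0_fin_numE.
Qed.

Lemma poisson_integral_mean h : (forall v, 0 <= h v) -> measurable_fun setT h ->
  (\int[nu]_v (h v)%:E < +oo)%E ->
  (\int[P]_w (poisson_integral h w)%:E = \int[nu]_v (h v)%:E)%E.
Proof.
move=> h0 mh hoo; rewrite -integral_poisson_mean//.
have J0 w : (0 <= \int[N w]_v (h v)%:E)%E.
  by apply: integral_ge0 => v _; rewrite lee_fin.
apply: ge0_ae_eq_integral => //.
- by apply/measurable_EFinP; exact: measurable_poisson_integral.
- exact: measurable_integral_poisson.
- by move=> w _; rewrite lee_fin poisson_integral_ge0.
- apply: filterS (poisson_integral_ae_lty h0 mh hoo) => w Jw _.
  by rewrite /poisson_integral fineK// ge0_fin_numE.
Qed.

(** Fatou's lemma along simple functions increasing to [h]. Where [poisson_integral h] is positive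
    the integral is finite, and the approximations converge to it. *)
Lemma poisson_integral_powR_le h q C : 0 < q -> (forall v, 0 <= h v) ->
  measurable_fun setT h ->
  (forall s : {nnsfun E >-> R}, (forall v, s v <= h v) ->
     (\int[P]_w (poisson_integral s w `^ q)%:E <= C)%E) ->
  (\int[P]_w (poisson_integral h w `^ q)%:E <= C)%E.
Proof.
move=> q0 h0 mh sC.
have [s [nds le_h sh]] := nnsfun_approximation h0 mh.
have s0 k v : (0 <= (s k v)%:E)%E by rewrite lee_fin.
have ms k : measurable_fun setT (EFin \o s k) by exact/measurable_EFinP.
have mpow (g : E -> R) : (forall v, 0 <= g v) -> measurable_fun setT g ->
    measurable_fun setT (fun w => poisson_integral g w `^ q).
  by move=> g0 mg; apply: measurable_fun_powR; exact: measurable_poisson_integral.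
apply: (@fatou_bound _ _ _ P _ (fun k w => poisson_integral (s k) w `^ q)).
- exact: mpow.
- by move=> w; exact: powR_ge0.
- by move=> k; exact: mpow.
- by move=> k w; exact: powR_ge0.
- move=> w; have [Sw|Sw] := eqVneq (poisson_integral h w) 0.
    by left; rewrite Sw powR0// gt_eqF.
  right; have {}Sw : 0 < poisson_integral h w.
    by rewrite lt0r Sw poisson_integral_ge0.
  apply: cvg_powR_gt0 => //.
  have Jfin : (\int[N w]_v (h v)%:E)%E \is a fin_num.
    by move: Sw; rewrite /poisson_integral; case: (integral _ _ _) => //=; rewrite ltxx.
  apply: fine_cvg; rewrite fineK//.
  rewrite (_ : (\int[N w]_v (h v)%:E)%E = (\int[N w]_v limn (fun k => (s k v)%:E))%E).
    exact: cvg_monotone_convergence.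
  by apply: eq_integral => v _; apply/esym/cvg_lim => //; exact: sh.
- by move=> k; exact: sC.
Qed.

(** [X] applies [fine] to each count and [poisson_integral] applies it to the whole sum, so they can
    differ only where some count is infinite. Domination is enough for upper bounds on moments. *)
Lemma nnsfun_mecke (s : {nnsfun E >-> R}) : (\int[nu]_v (s v)%:E < +oo)%E ->
  exists n (a c : 'I_n -> R) (X : Omega -> R),
  [/\ [/\ forall i, 0 <= a i, forall i, 0 <= c i, measurable_fun setT X &
          forall w, 0 <= X w],
    forall phi : R -> R, (forall x, 0 <= phi x) -> measurable_fun setT phi ->
      (\int[P]_w (X w * phi (X w))%:E =
       \sum_(i < n) (a i * c i)%:E * \int[P]_w (phi (X w + a i))%:E)%E,
    forall w, poisson_integral s w <= X w &
    forall phi : R -> R, phi 0 = 0 -> (forall x, 0 <= x -> 0 <= phi x) ->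
      (\int[nu]_v (phi (s v))%:E = (\sum_(i < n) phi (a i) * c i)%:E)%E].
Proof.
move=> soo; have [n [a [As [a0 mA tA Aoo intE]]]] := nnsfun_integral_level_sets soo.
pose c i := fine (nu (As i)).
have nuE i : nu (As i) = (c i)%:E by rewrite fineK// ge0_fin_numE.
exists n, a, c, (poisson_sum N a As); split.
- split => // [i||w]; first exact: fine_ge0.
  + exact: (measurable_poisson_sum hN).
  + exact: poisson_sum_ge0.
- exact: (poisson_sum_mecke hN).
- move=> w; rewrite /poisson_integral (intE (N w) id)//.
  apply: (le_trans (ge0_fine_sum_le _)).
    by move=> i; rewrite mule_ge0// lee_fin.
  by apply: ler_sum => i _; rewrite ge0_fineMl.
- move=> phi phi0 phi_ge0; rewrite intE//; under eq_bigr do rewrite nuE -EFinM.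
  by rewrite sumEFin.
Qed.

(** The bounds [A] and [B] on the mean are kept apart: the first factor depends only on [q] and the
    fixed [B], so the estimate is small as soon as [A] and [D] are. *)
Lemma poisson_integral_moment h q A B D : 0 < q -> (forall v, 0 <= h v) ->
  measurable_fun setT h -> 0 < B -> A <= B ->
  (\int[nu]_v (h v)%:E <= A%:E)%E ->
  (\int[nu]_v (h v `^ (q + 1))%:E <= D%:E)%E ->
  (\int[P]_w (poisson_integral h w `^ (q + 1))%:E <=
  (2 * 2 `^ q * (1 + (2 * 2 `^ q * B) `^ q) * (A + D))%:E)%E.
Proof.
move=> q0 h0 mh B0 AB hA hD.
have q10 : 0 < q + 1 by rewrite addr_gt0.
apply: poisson_integral_powR_le => // s sh.
have sA : (\int[nu]_v (s v)%:E <= A%:E)%E.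
  by apply: le_trans (ge0_le_integral_EFin nu _ mh _ sh) hA.
have sD : (\int[nu]_v (s v `^ (q + 1))%:E <= D%:E)%E.
  apply: le_trans hD; apply: ge0_le_integral_EFin.
  - exact: measurable_fun_powR.
  - exact: measurable_fun_powR.
  - by move=> v; exact: powR_ge0.
  - by move=> v; rewrite ge0_ler_powR ?nnegrE ?(ltW q10).
have [n [a [c [X [[a0 c0 mX X0] mecke SX intE]]]]] :=
  nnsfun_mecke (le_lt_trans sA (ltry _)).
have bA : \sum_(i < n) a i * c i <= A by move: sA; rewrite (intE id).
have bD : \sum_(i < n) a i `^ (q + 1) * c i <= D.
  move: sD; rewrite (intE (@powR R ^~ (q + 1)))//.
  - by rewrite powR0// gt_eqF.
  - by move=> x _; exact: powR_ge0.
apply: (@le_trans _ _ (\int[P]_w (X w `^ (q + 1))%:E)%E).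
  apply: ge0_le_integral_EFin.
  - by apply: measurable_fun_powR; exact: measurable_poisson_integral.
  - exact: measurable_fun_powR.
  - by move=> w; exact: powR_ge0.
  - move=> w; rewrite ge0_ler_powR ?nnegrE ?(ltW q10)//.
    exact: poisson_integral_ge0.
apply: (le_trans (mecke_moment a0 c0 mX X0 mecke q0 B0 (le_trans bA AB))).
rewrite lee_fin ler_wpM2l//; last exact: lerD.
by rewrite mulr_ge0 ?addr_ge0 ?powR_ge0// mulr_ge0 ?powR_ge0.
Qed.

Lemma poisson_integral_second_moment h A D : (forall v, 0 <= h v) ->
  measurable_fun setT h ->
  (\int[nu]_v (h v)%:E <= A%:E)%E ->
  (\int[nu]_v (h v ^+ 2)%:E <= D%:E)%E ->
  (\int[P]_w (poisson_integral h w ^+ 2)%:E <= (A ^+ 2 + D)%:E)%E.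
Proof.
move=> h0 mh hA hD.
have S0 g w : (forall v, 0 <= g v) -> 0 <= poisson_integral g w.
  exact: poisson_integral_ge0.
under eq_integral do rewrite -powR_mulrn ?S0//.
apply: poisson_integral_powR_le => // s sh.
under eq_integral do rewrite powR_mulrn ?S0//.
have sA : (\int[nu]_v (s v)%:E <= A%:E)%E.
  by apply: le_trans (ge0_le_integral_EFin nu _ mh _ sh) hA.
have sD : (\int[nu]_v (s v ^+ 2)%:E <= D%:E)%E.
  apply: le_trans hD; apply: ge0_le_integral_EFin.
  - exact: measurable_funX.
  - exact: measurable_funX.
  - by move=> v; exact: sqr_ge0.
  - by move=> v; rewrite ler_sqr ?nnegrE.
have [n [a [c [X [[a0 c0 mX X0] mecke SX intE]]]]] :=
  nnsfun_mecke (le_lt_trans sA (ltry _)).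
have b0 : 0 <= \sum_(i < n) a i * c i by apply: sumr_ge0 => i _; rewrite mulr_ge0.
have bA : \sum_(i < n) a i * c i <= A by move: sA; rewrite (intE id).
have bD : \sum_(i < n) a i ^+ 2 * c i <= D.
  move: sD; rewrite (intE (fun x => x ^+ 2)) ?expr0n//.
  by move=> x _; exact: sqr_ge0.
apply: (@le_trans _ _ (\int[P]_w (X w ^+ 2)%:E)%E).
  apply: ge0_le_integral_EFin.
  - by apply: measurable_funX; exact: measurable_poisson_integral.
  - exact: measurable_funX.
  - by move=> w; exact: sqr_ge0.
  - by move=> w; rewrite ler_sqr ?nnegrE// S0.
rewrite (mecke_second_moment a0 mX X0 mecke) lee_fin lerD//.
by rewrite ler_sqr ?nnegrE// (le_trans b0).
Qed.

Lemma poisson_integral_variance h A D : (forall v, 0 <= h v) ->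
  measurable_fun setT h ->
  (\int[nu]_v (h v)%:E = A%:E)%E ->
  (\int[nu]_v (h v ^+ 2)%:E <= D%:E)%E ->
  (\int[P]_w ((poisson_integral h w - A) ^+ 2)%:E <= D%:E)%E.
Proof.
move=> h0 mh hA hD.
have A0 : 0 <= A.
  by rewrite -lee_fin -hA; apply: integral_ge0 => v _; rewrite lee_fin.
have mS := measurable_poisson_integral h0 mh.
have S0 w := poisson_integral_ge0 w h0.
have mS2 : measurable_fun setT (fun w => (poisson_integral h w - A) ^+ 2).
  by apply: measurable_funX; exact: measurable_funB.
have h2 : (\int[P]_w (poisson_integral h w ^+ 2)%:E <= (A ^+ 2 + D)%:E)%E.
  by apply: poisson_integral_second_moment; rewrite ?hA.
(* Subtraction of integrals is avoided: (S - A)^2 + 2 A S = S^2 + A^2 is integrated, with E[S] =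
   A. *)
rewrite -(@leeD2rE _ (2 * A * A)%:E)//.
have -> : (\int[P]_w ((poisson_integral h w - A) ^+ 2)%:E + (2 * A * A)%:E =
    \int[P]_w (poisson_integral h w ^+ 2)%:E + (A ^+ 2)%:E)%E.
  rewrite -[X in (_ = _ + X)%E](integral_probability_cst P) -ge0_integralD_EFin//.
  - have -> : (2 * A * A)%:E = (\int[P]_w (2 * A * poisson_integral h w)%:E)%E.
      rewrite ge0_integralZl_EFin_fun ?mulr_ge0//.
      by rewrite poisson_integral_mean ?hA ?ltry// -EFinM.
    rewrite -ge0_integralD_EFin//.
    + by apply: eq_integral => w _; congr EFin; ring.
    + exact: measurable_funM.
    + by move=> w; exact: sqr_ge0.
    + by move=> w; rewrite !mulr_ge0.
  - exact: measurable_funX.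
  - by move=> w; exact: sqr_ge0.
  - by move=> _; exact: sqr_ge0.
apply: (le_trans (leeD2r _ h2)); rewrite -!EFinD lee_fin; lra.
Qed.

End poisson_integral.

(** * A quantitative law of large numbers *)

Section interpolation.
Context {R : realType}.

(** The three terms bound the left-hand side on x <= eta, on eta < x < M and on x >= M
    respectively. *)
Lemma powR_interpolation (x p eta M : R) : 0 <= x -> 0 < p -> 0 < eta -> 0 < M ->
  x `^ p <= eta `^ p + M `^ p / eta ^+ 2 * x ^+ 2 + x `^ (p + 1) / M.
Proof.
move=> x0 p0 e0 M0.
have h1 : 0 <= eta `^ p by exact: powR_ge0.
have h2 : 0 <= M `^ p / eta ^+ 2 * x ^+ 2.
  by rewrite !mulr_ge0 ?powR_ge0 ?invr_ge0 ?sqr_ge0.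
have h3 : 0 <= x `^ (p + 1) / M by rewrite divr_ge0 ?powR_ge0// ltW.
case: (leP x eta) => [xe|ex].
  have : x `^ p <= eta `^ p by rewrite ge0_ler_powR ?nnegrE// ltW.
  lra.
case: (leP M x) => [Mx|xM].
  have : x `^ p <= x `^ (p + 1) / M.
    by rewrite powRD1// -mulrA ler_peMr ?powR_ge0// ler_pdivlMr// mul1r.
  lra.
have h4 : x `^ p <= M `^ p by rewrite ge0_ler_powR ?nnegrE// ltW.
have : M `^ p <= M `^ p / eta ^+ 2 * x ^+ 2.
  rewrite -mulrA ler_peMr ?powR_ge0// mulrC ler_pdivlMr ?exprn_gt0// mul1r.
  by rewrite ler_sqr ?nnegrE// ltW.
lra.
Qed.

Lemma powR_norm_sub_le (x a p : R) : 0 <= x -> 0 <= a -> 0 <= p ->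
  `|x - a| `^ p <= 2 `^ p * (x `^ p + a `^ p).
Proof.
move=> x0 a0 p0; apply: le_trans (powR_sum_le2 x0 a0 p0).
rewrite ge0_ler_powR ?nnegrE ?addr_ge0//.
by apply: le_trans (ler_normB _ _) _; rewrite !ger0_norm.
Qed.

Lemma powR_min_one_sub_le (x p : R) : 0 <= x -> 1 <= p ->
  x - Num.min x 1 <= x `^ p /\ (x - Num.min x 1) `^ p <= x `^ p.
Proof.
move=> x0 p1; have p0 : 0 <= p by lra.
have mx : Num.min x 1 <= x by rewrite ge_min lexx.
have m0 : 0 <= Num.min x 1 by rewrite le_min x0 ler01.
split; last by rewrite ge0_ler_powR ?nnegrE//; lra.
case: (leP x 1) => x1; first by rewrite subrr powR_ge0.
have : x `^ 1 <= x `^ p by rewrite ler_powR// ltW.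
rewrite powRr1//; lra.
Qed.

(** For theta <= 1 the smallest exponent gives the largest power, so theta^(1 / (8 p)) dominates
    every error term of the interpolation. *)
Lemma powR_exponent_bounds (p : R) : 1 < p ->
  [/\ (8 * p)^-1 <= 8^-1, (8 * p)^-1 <= 8^-1 * p,
      (8 * p)^-1 <= 2^-1 & (8 * p)^-1 <= (4 * p)^-1].
Proof.
move=> p1; have p0 : 0 < p by exact: lt_trans p1.
have h : (8 * p)^-1 <= 8^-1 by rewrite lef_pV2 ?posrE ?mulr_gt0//; lra.
split => //; [lra|lra|].
rewrite lef_pV2 ?posrE ?mulr_gt0//; lra.
Qed.

End interpolation.

Section law_of_large_numbers.
Context dO dE (Omega : measurableType dO) (E : measurableType dE)
  (R : realType) (P : probability Omega R).
Variables (N : Omega -> {measure set E -> \bar R}) (nu : {measure set E -> \bar R}).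
Hypothesis hN : is_poisson_random_measure P N nu.

Let moment_const (q B : R) := 2 * 2 `^ q * (1 + (2 * 2 `^ q * B) `^ q).

Let moment_const_ge0 q B : 0 <= moment_const q B.
Proof.
by rewrite /moment_const mulr_ge0 ?addr_ge0 ?powR_ge0// mulr_ge0 ?powR_ge0.
Qed.

(* Interpolates between the second moment, which is small, and the moment of order
   q + 2, which is bounded, by [powR_interpolation] with [eta] a small and [M] a
   large power of [theta]. *)
Lemma bounded_poisson_integral_concentration (h : E -> R) (q b B v theta : R) :
  0 < q -> 0 < B -> b <= B -> 0 <= v -> 0 < theta <= 1 ->
  (forall u, 0 <= h u) -> (forall u, h u <= 1) -> measurable_fun setT h ->
  (\int[nu]_u (h u)%:E = b%:E)%E ->
  (\int[nu]_u (h u ^+ 2)%:E <= (v * theta)%:E)%E ->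
  (\int[P]_w (`|poisson_integral N h w - b| `^ (q + 1))%:E <=
   ((1 + v + 2 `^ (q + 1 + 1) * (moment_const (q + 1) B * (B + B) + B `^ (q + 1 + 1)))
     * theta `^ (8 * (q + 1))^-1)%:E)%E.
Proof.
move=> q0 B0 bB v0 /andP[t0 t1] h0 h1 mh hb h2.
set p := q + 1; set C := _ + B `^ _.
have p0 : 0 < p by rewrite addr_gt0.
have p1 : 1 < p by rewrite /p ltrDr.
have b0 : 0 <= b.
  by rewrite -lee_fin -hb; apply: integral_ge0 => u _; rewrite lee_fin.
pose X := poisson_integral N h.
have X0 w : 0 <= X w by exact: poisson_integral_ge0.
have mX : measurable_fun setT X by exact: (measurable_poisson_integral hN).
have mXb : measurable_fun setT (fun w => X w - b) by exact: measurable_funB.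
have mn : measurable_fun setT (fun w => `|X w - b|) by exact: measurableT_comp.
have var : (\int[P]_w (`|X w - b| ^+ 2)%:E <= (v * theta)%:E)%E.
  under eq_integral do rewrite real_normK ?num_real//.
  exact: (poisson_integral_variance hN).
have mom : (\int[P]_w (`|X w - b| `^ (p + 1))%:E <= (2 `^ (p + 1) * C)%:E)%E.
  apply: (@le_trans _ _ (\int[P]_w (2 `^ (p + 1) * (X w `^ (p + 1) + B `^ (p + 1)))%:E)%E).
    apply: ge0_le_integral_EFin.
    - exact: measurable_fun_powR.
    - apply: measurable_funM => //; apply: measurable_funD => //.
      exact: measurable_fun_powR.
    - by move=> w; exact: powR_ge0.
    - move=> w; apply: (le_trans (powR_norm_sub_le _ _ _)) => //.
        by rewrite addr_ge0// ltW.
      rewrite ler_wpM2l ?powR_ge0// lerD2l ge0_ler_powR ?nnegrE ?addr_ge0//;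
        by rewrite ltW.
  rewrite ge0_integralZl_EFin_fun ?powR_ge0//; last 2 first.
  - by apply: measurable_funD => //; exact: measurable_fun_powR.
  - by move=> w; rewrite addr_ge0 ?powR_ge0.
  rewrite EFinM lee_pmul2l ?lte_fin ?powR_gt0//.
  rewrite ge0_integralD_EFin//; last 3 first.
  - exact: measurable_fun_powR.
  - by move=> w; exact: powR_ge0.
  - by move=> w; exact: powR_ge0.
  rewrite integral_probability_cst /C EFinD leeD2r//.
  apply: (poisson_integral_moment hN) => //.
  - by rewrite hb lee_fin.
  (* Since 0 <= h <= 1, h^(p + 1) <= h, so the integral of h^(p + 1) is at most [b]. *)
  - apply: (@le_trans _ _ b%:E); last by rewrite lee_fin.
    rewrite -hb; apply: ge0_le_integral_EFin => //.
    - exact: measurable_fun_powR.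
    - by move=> u; exact: powR_ge0.
    - move=> u; have [->|u0] := eqVneq (h u) 0.
        by rewrite powR0// gt_eqF// addr_gt0.
      rewrite -[leRHS]powRr1// ger_powR ?h1 ?lt0r ?u0 ?h0//; lra.
(* The middle term of the interpolation becomes theta^(-1/4 - 1/4 + 1) = theta^(1/2), and the outer
   ones theta^(p/8) and theta^(1 / (4 p)), up to constants. *)
pose eta := theta `^ (8^-1); pose M := theta `^ (- (4 * p)^-1).
pose r := (8 * p)^-1.
have eta0 : 0 < eta by exact: powR_gt0.
have M0 : 0 < M by exact: powR_gt0.
have Mp0 : 0 <= M `^ p / eta ^+ 2 by rewrite divr_ge0 ?powR_ge0// exprn_ge0// ltW.
have tr s : r <= s -> theta `^ s <= theta `^ r by move=> ?; rewrite ger_powR// t0.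
have [r8 rp r2 r4] := powR_exponent_bounds p1.
have e1 : eta `^ p <= theta `^ r.
  by rewrite -powRrM; exact: tr.
have e2 : M `^ p / eta ^+ 2 * (v * theta) <= v * theta `^ r.
  have -> : M `^ p / eta ^+ 2 * (v * theta) = v * theta `^ (2^-1).
    rewrite -powR_mulrn ?powR_ge0// -!powRrM.
    rewrite mulrCA; congr (_ * _); rewrite -powRN.
    rewrite -[X in _ * X]powRr1 ?(ltW t0)//.
    rewrite -!powRD ?(gt_eqF t0) ?implybT//; congr (_ `^ _).
    by field; rewrite gt_eqF.
  by rewrite ler_wpM2l// tr.
have e3 : M^-1 <= theta `^ r.
  by rewrite -powRN opprK; exact: tr.
have C0 : 0 <= C.
  by rewrite addr_ge0 ?powR_ge0// mulr_ge0// addr_ge0// ltW.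
apply: (@le_trans _ _ (\int[P]_w (eta `^ p + M `^ p / eta ^+ 2 * `|X w - b| ^+ 2 +
    M^-1 * `|X w - b| `^ (p + 1))%:E)%E).
  apply: ge0_le_integral_EFin.
  - exact: measurable_fun_powR.
  - apply: measurable_funD; first apply: measurable_funD => //.
    + by apply: measurable_funM => //; exact: measurable_funX.
    + by apply: measurable_funM => //; exact: measurable_fun_powR.
  - by move=> w; exact: powR_ge0.
  - by move=> w; rewrite [M^-1 * _]mulrC; apply: powR_interpolation.
have mq : measurable_fun setT (fun w => M `^ p / eta ^+ 2 * `|X w - b| ^+ 2).
  by apply: measurable_funM => //; exact: measurable_funX.
rewrite ge0_integralD_EFin; last 4 first.
- by apply: measurable_funD.
- by apply: measurable_funM => //; exact: measurable_fun_powR.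
- by move=> w; rewrite addr_ge0 ?powR_ge0// mulr_ge0// exprn_ge0.
- by move=> w; rewrite mulr_ge0 ?powR_ge0// invr_ge0 ltW.
rewrite ge0_integralD_EFin//; last 2 first.
- by move=> w; exact: powR_ge0.
- by move=> w; rewrite mulr_ge0// exprn_ge0.
rewrite integral_probability_cst ge0_integralZl_EFin_fun//; last exact: measurable_funX.
rewrite ge0_integralZl_EFin_fun ?invr_ge0 ?(ltW M0)//; last exact: measurable_fun_powR.
apply: (@le_trans _ _ ((eta `^ p)%:E + (M `^ p / eta ^+ 2)%:E * (v * theta)%:E +
   (M^-1)%:E * (2 `^ (p + 1) * C)%:E)%E).
  apply: leeD; [apply: leeD => //|]; apply: lee_wpmul2l => //.
  by rewrite lee_fin invr_ge0 ltW.
rewrite -!EFinM -!EFinD lee_fin.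
have : M^-1 * (2 `^ (p + 1) * C) <= theta `^ r * (2 `^ (p + 1) * C).
  by rewrite ler_wpM2r// mulr_ge0// powR_ge0.
move=> e4; rewrite -/r 2!mulrDl mul1r; apply: lerD; first exact: lerD.
by rewrite [leRHS]mulrC.
Qed.

(* The function [f / t] is split into [h1 = min(f, 1) / t], to which the previous
   bound applies, and [h2 = (f - min(f, 1)) / t], which is dominated by [f^(q+1) / t]. *)
Lemma poisson_integral_lln (q B : R) : 0 < q -> 1 <= B ->
  exists C : R, 0 <= C /\ forall (f : E -> R) (t b theta : R),
    measurable_fun setT f -> (forall u, 0 <= f u) ->
    1 <= t -> 0 < theta <= 1 -> t^-1 <= theta -> b <= B ->
    (\int[nu]_u (f u)%:E = (b * t)%:E)%E ->
    (\int[nu]_u (f u `^ (q + 1))%:E <= (theta * t)%:E)%E ->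
    (\int[P]_w (`|poisson_integral N f w / t - b| `^ (q + 1))%:E <=
      (C * theta `^ (8 * (q + 1))^-1)%:E)%E.
Proof.
move=> q0 B1; set p := q + 1.
have B0 : 0 < B by exact: lt_le_trans B1.
have p1 : 1 < p by rewrite /p ltrDr.
have p0 : 0 < p by exact: lt_trans p1.
(* [C1] is the constant of [bounded_poisson_integral_concentration] with [v := B]; [C2] comes from
   [poisson_integral_moment] with mean and moment bounds both equal to theta. *)
pose C1 := 1 + B + 2 `^ (p + 1) * (moment_const p B * (B + B) + B `^ (p + 1)).
pose C2 := 2 `^ p * (moment_const q B * (1 + 1) + 1).
have C10 : 0 <= C1.
  rewrite /C1 !addr_ge0 ?mulr_ge0 ?addr_ge0 ?powR_ge0// ?(ltW B0)//.
  by rewrite mulr_ge0// addr_ge0 ?(ltW B0).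
have C20 : 0 <= C2.
  by rewrite /C2 mulr_ge0 ?powR_ge0// addr_ge0// mulr_ge0.
exists (2 `^ p * (C1 + C2)); split; first by rewrite mulr_ge0 ?powR_ge0// addr_ge0.
move=> f t b theta mf f0 t1 /andP[th0 th1] tth bB hf hfp.
have t0 : 0 < t by exact: lt_le_trans t1.
have ti0 : 0 <= t^-1 by rewrite invr_ge0 ltW.
have ti1 : t^-1 <= 1 by rewrite invf_le1.
have b0 : 0 <= b.
  rewrite -(pmulr_lge0 _ t0) -lee_fin -hf; apply: integral_ge0 => u _.
  by rewrite lee_fin.
pose h1 u := t^-1 * Num.min (f u) 1; pose h2 u := t^-1 * (f u - Num.min (f u) 1).
have m0 u : 0 <= Num.min (f u) 1 by rewrite le_min f0 ler01.
have mle u : Num.min (f u) 1 <= f u by rewrite ge_min lexx.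
have mm : measurable_fun setT (fun u => Num.min (f u) 1) by exact: measurable_minr.
have mfm : measurable_fun setT (fun u => f u - Num.min (f u) 1) by exact: measurable_funB.
have fm0 u : 0 <= f u - Num.min (f u) 1 by rewrite subr_ge0.
have h10 u : 0 <= h1 u by rewrite mulr_ge0.
have h20 u : 0 <= h2 u by rewrite mulr_ge0.
have mh1 : measurable_fun setT h1 by exact: measurable_funM.
have mh2 : measurable_fun setT h2 by exact: measurable_funM.
have fh u : f u = t * (h1 u + h2 u) by rewrite /h1 /h2; field; rewrite gt_eqF.
have If (m : {measure set E -> \bar R}) : (\int[m]_u (f u)%:E =
    t%:E * (\int[m]_u (h1 u)%:E + \int[m]_u (h2 u)%:E))%E.
  rewrite -ge0_integralD_EFin// -ge0_integralZl_EFin_fun ?(ltW t0)//.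
  - by apply: eq_integral => u _; rewrite fh.
  - exact: measurable_funD.
  - by move=> u; rewrite addr_ge0.
have I10 : (0 <= \int[nu]_u (h1 u)%:E)%E by apply: integral_ge0 => u _; rewrite lee_fin.
have I20 : (0 <= \int[nu]_u (h2 u)%:E)%E by apply: integral_ge0 => u _; rewrite lee_fin.
have I12 : (\int[nu]_u (h1 u)%:E + \int[nu]_u (h2 u)%:E = b%:E)%E.
  rewrite -ge0_integralD_EFin//; transitivity (\int[nu]_u (t^-1 * f u)%:E)%E.
    by apply: eq_integral => u _; congr EFin; rewrite /h1 /h2; ring.
  by rewrite ge0_integralZl_EFin_fun// hf -EFinM mulrCA mulVf ?mulr1// gt_eqF.
have I1fin : (\int[nu]_u (h1 u)%:E)%E \is a fin_num.
  rewrite ge0_fin_numE//; apply: le_lt_trans (ltry b); rewrite -I12.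
  exact: leeDl.
have I2fin : (\int[nu]_u (h2 u)%:E)%E \is a fin_num.
  rewrite ge0_fin_numE//; apply: le_lt_trans (ltry b); rewrite -I12.
  exact: leeDr.
pose b1 := fine (\int[nu]_u (h1 u)%:E)%E; pose b2 := fine (\int[nu]_u (h2 u)%:E)%E.
have b1E : (\int[nu]_u (h1 u)%:E)%E = b1%:E by rewrite fineK.
have b2E : (\int[nu]_u (h2 u)%:E)%E = b2%:E by rewrite fineK.
have b10 : 0 <= b1 by exact: fine_ge0.
have b20 : 0 <= b2 by exact: fine_ge0.
have b12 : b1 + b2 = b by move: I12; rewrite b1E b2E -EFinD => -[].
have fp_le : (t^-1%:E * \int[nu]_u (f u `^ p)%:E <= theta%:E)%E.
  apply: (@le_trans _ _ (t^-1%:E * (theta * t)%:E)%E); first exact: lee_wpmul2l.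
  by rewrite -EFinM lee_fin mulrCA mulVf ?mulr1// gt_eqF.
have mfp : measurable_fun setT (fun u => t^-1 * f u `^ p).
  by apply: measurable_funM => //; exact: measurable_fun_powR.
have ZfpE : (t^-1%:E * \int[nu]_u (f u `^ p)%:E = \int[nu]_u (t^-1 * f u `^ p)%:E)%E.
  rewrite ge0_integralZl_EFin_fun//; first exact: measurable_fun_powR.
  by move=> u; exact: powR_ge0.
have I2th : (\int[nu]_u (h2 u)%:E <= theta%:E)%E.
  apply: le_trans fp_le; rewrite ZfpE.
  apply: ge0_le_integral_EFin => // u; rewrite ler_wpM2l//.
  by have [] := powR_min_one_sub_le (f0 u) (ltW p1).
(* Besides the bound on the excess over 1, this uses t^(-p) <= t^(-1), valid as t >= 1. *)
have I2p : (\int[nu]_u (h2 u `^ p)%:E <= theta%:E)%E.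
  apply: le_trans fp_le; rewrite ZfpE.
  apply: ge0_le_integral_EFin => //.
  - exact: measurable_fun_powR.
  - by move=> u; exact: powR_ge0.
  move=> u; rewrite powRM// ler_pM ?powR_ge0//.
    by rewrite -[leRHS]powRr1// ger_powR ?invr_gt0 ?t0 ?ti1// ltW.
  by have [] := powR_min_one_sub_le (f0 u) (ltW p1).
have b2th : b2 <= theta by rewrite -lee_fin -b2E.
have S1 := @bounded_poisson_integral_concentration h1 q b1 B B theta q0 B0.
have {}S1 : (\int[P]_w (`|poisson_integral N h1 w - b1| `^ p)%:E <=
    (C1 * theta `^ (8 * p)^-1)%:E)%E.
  apply: S1 => //.
  - by lra.
  - exact: ltW.
  - by rewrite th0.
  - by move=> u; rewrite /h1 mulr_ile1// ge_min lexx orbT.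
  (* As h1 <= 1 / t, h1^2 <= h1 / t, whose integral is at most B theta. *)
  - apply: (@le_trans _ _ (\int[nu]_u (t^-1 * h1 u)%:E)%E).
      apply: ge0_le_integral_EFin => //.
      + exact: measurable_funX.
      + exact: measurable_funM.
      + by move=> u; exact: sqr_ge0.
      + move=> u; rewrite /h1 expr2 -!mulrA ler_wpM2l// mulrCA ler_wpM2l//.
        by rewrite ler_piMl// ge_min lexx orbT.
    rewrite ge0_integralZl_EFin_fun// b1E -EFinM lee_fin mulrC ler_pM//.
    lra.
(* No cancellation is used here: the Poisson integral of [h2] and its mean [b2] are each small. *)
have S2 : (\int[P]_w (`|poisson_integral N h2 w - b2| `^ p)%:E <=
    (C2 * theta `^ (8 * p)^-1)%:E)%E.
  apply: (@le_trans _ _ (\int[P]_w (2 `^ p * (poisson_integral N h2 w `^ p + b2 `^ p))%:E)%E).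
    apply: ge0_le_integral_EFin.
    - apply: measurable_fun_powR; apply: measurableT_comp => //.
      by apply: measurable_funB => //; exact: (measurable_poisson_integral hN).
    - apply: measurable_funM => //; apply: measurable_funD => //.
      by apply: measurable_fun_powR; exact: (measurable_poisson_integral hN).
    - by move=> w; exact: powR_ge0.
    - move=> w; apply: powR_norm_sub_le => //; last exact: ltW.
      exact: poisson_integral_ge0.
  have mS2 : measurable_fun setT (fun w => poisson_integral N h2 w `^ p).
    by apply: measurable_fun_powR; exact: (measurable_poisson_integral hN).
  rewrite ge0_integralZl_EFin_fun ?powR_ge0//; last 2 first.
  - exact: measurable_funD.
  - by move=> w; rewrite addr_ge0 ?powR_ge0.
  rewrite /C2 -mulrA EFinM lee_pmul2l ?lte_fin ?powR_gt0//.
  rewrite ge0_integralD_EFin//; last 2 first.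
  - by move=> w; exact: powR_ge0.
  - by move=> w; exact: powR_ge0.
  rewrite integral_probability_cst.
  have := @poisson_integral_moment _ _ _ _ _ P N nu hN h2 q theta B theta q0 h20 mh2 B0.
  move=> /(_ (le_trans th1 B1) I2th I2p).
  rewrite -[X in (_ <= (X * _)%:E)%E -> _]/(moment_const q B) => h.
  apply: (le_trans (leeD2r _ h)); rewrite -EFinD lee_fin.
  have thr : theta <= theta `^ (8 * p)^-1.
    rewrite -[leLHS]powRr1 ?(ltW th0)// ger_powR ?th0//.
    by rewrite invf_le1; lra.
  have b2p : b2 `^ p <= theta.
    apply: (@le_trans _ _ (theta `^ p)); first by rewrite ge0_ler_powR ?nnegrE ?(ltW p0) ?(ltW th0).
    by rewrite -[leRHS]powRr1 ?(ltW th0)// ger_powR ?th0// ltW.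
  have : moment_const q B * (theta + theta) <=
      moment_const q B * (theta `^ (8 * p)^-1 + theta `^ (8 * p)^-1).
    by rewrite ler_wpM2l// lerD.
  lra.
(* Only almost sure: where the integral of [f] is infinite, [poisson_integral] is 0 and need not be
   additive. *)
have Sae : {ae P, forall w, poisson_integral N f w / t - b =
    (poisson_integral N h1 w - b1) + (poisson_integral N h2 w - b2)}.
  have foo : (\int[nu]_u (f u)%:E < +oo)%E by rewrite hf ltry.
  apply: filterS (poisson_integral_ae_lty hN f0 mf foo) => w.
  rewrite If => Joo.
  have J10 : (0 <= \int[N w]_u (h1 u)%:E)%E.
    by apply: integral_ge0 => u _; rewrite lee_fin.
  have J20 : (0 <= \int[N w]_u (h2 u)%:E)%E.
    by apply: integral_ge0 => u _; rewrite lee_fin.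
  have J12 : (\int[N w]_u (h1 u)%:E + \int[N w]_u (h2 u)%:E < +oo)%E.
    rewrite ltey; apply: contraTneq Joo => ->.
    by rewrite gt0_muley ?lte_fin// ltxx.
  have J1f : (\int[N w]_u (h1 u)%:E)%E \is a fin_num.
    rewrite ge0_fin_numE//; apply: le_lt_trans J12; exact: leeDl.
  have J2f : (\int[N w]_u (h2 u)%:E)%E \is a fin_num.
    rewrite ge0_fin_numE//; apply: le_lt_trans J12; exact: leeDr.
  rewrite /poisson_integral If -(fineK J1f) -(fineK J2f) -EFinD -EFinM /= -b12.
  by field; rewrite gt_eqF.
have mS (h : E -> R) : (forall u, 0 <= h u) -> measurable_fun setT h ->
    forall b : R, measurable_fun setT (fun w => `|poisson_integral N h w - b| `^ p).
  move=> h0 mh b'; apply: measurable_fun_powR; apply: measurableT_comp => //.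
  by apply: measurable_funB => //; exact: (measurable_poisson_integral hN).
apply: (@le_trans _ _ (\int[P]_w (2 `^ p * (`|poisson_integral N h1 w - b1| `^ p +
   `|poisson_integral N h2 w - b2| `^ p))%:E)%E).
  apply: ae_ge0_le_integral => //.
  - apply/measurable_EFinP; apply: measurable_fun_powR.
    apply: measurableT_comp => //; apply: measurable_funB => //.
    by apply: measurable_funM => //; exact: (measurable_poisson_integral hN).
  - apply/measurable_EFinP; apply: measurable_funM => //.
    by apply: measurable_funD; exact: mS.
  - apply: filterS Sae => w -> _; rewrite lee_fin.
    apply: le_trans (powR_sum_le2 _ _ _) => //; last exact: ltW.
    rewrite ge0_ler_powR ?(ltW p0) ?nnegrE ?addr_ge0//.
    exact: ler_normD.
rewrite ge0_integralZl_EFin_fun ?powR_ge0//; last first.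
  by apply: measurable_funD; exact: mS.
rewrite ge0_integralD_EFin//; last 2 first.
- exact: mS.
- exact: mS.
rewrite -mulrA EFinM lee_pmul2l ?lte_fin ?powR_gt0// mulrDl EFinD.
exact: leeD.
Qed.

End law_of_large_numbers.

(** * The heat kernel *)

Section integral_restriction.
Context d (T : measurableType d) (R : realType) (mu : {measure set T -> \bar R}).
Import HBNNSimple.

(** Simple functions below [f] also vanish off [D], so their level sets lie in [D] and restriction
    does not change their measure. *)
Lemma ge0_integral_mrestr (D : set T) (mD : measurable D) (f : T -> R) :
  measurable_fun setT f -> (forall x, 0 <= f x) -> (forall x, ~ D x -> f x = 0) ->
  (\int[mrestr mu mD]_x (f x)%:E = \int[mu]_x (f x)%:E)%E.
Proof.
move=> mf f0 fD; have [s [nds le_f sf]] := nnsfun_approximation f0 mf.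
have s0 k v : (0 <= (s k v)%:E)%E by rewrite lee_fin.
have ms k : measurable_fun setT (EFin \o s k) by exact/measurable_EFinP.
have lims (m : {measure set T -> \bar R}) :
    (\int[m]_v (f v)%:E = limn (fun k => \int[m]_v (s k v)%:E))%E.
  rewrite -monotone_convergence//.
  by apply: eq_integral => v _; apply/esym/cvg_lim => //; exact: sf.
rewrite !lims; congr (limn _); apply/funext => k.
have [n [a [A [a0 mA tA phiE]]]] := nnsfun_level_sets (s k).
have sE x : s k x = \sum_(i < n) a i * \1_(A i) x by exact: (phiE id).
under eq_integral do rewrite sE.
under [in RHS]eq_integral do rewrite sE.
rewrite !ge0_integral_sum_indic//; try by move=> i; exact: ltW.
apply: eq_bigr => i _; congr (_ * mu _)%E; apply/setIidl => x Ax.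
apply: contrapT => /fD fx0; have := le_f k x; rewrite fx0 sE leNgt => /negP; apply.
rewrite (bigD1 i)//= indicE mem_set// mulr1 ltr_pwDl// sumr_ge0// => j _.
by rewrite mulr_ge0// ltW.
Qed.

End integral_restriction.

(** The intensity is built with [\x^], which accepts a bare [lambda]; the integrals are computed
    with [\x]. For sigma-finite factors the two agree by uniqueness of the product measure. *)
Lemma ge0_integral_product_measure2 d1 d2 (T1 : measurableType d1)
    (T2 : measurableType d2) (R : realType)
    (m1 : {sigma_finite_measure set T1 -> \bar R})
    (m2 : {sigma_finite_measure set T2 -> \bar R}) (f : T1 * T2 -> \bar R) :
  (\int[m1 \x^ m2]_v f v = \int[m1 \x m2]_v f v)%E.
Proof.
apply: eq_measure_integral => A mA _; apply/esym.
by apply: product_measure_unique => // *; exact: product_measure2E.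
Qed.

Section product_integral.
Context {R : realType}.
Local Notation T := (measurableTypeR R).

Lemma measurable_tnth_fun d (phi : T -> R) (i : 'I_d) : measurable_fun setT phi ->
  measurable_fun setT (fun x : d.-tuple T => phi (tnth x i)).
Proof. by move=> mphi; apply: (measurableT_comp mphi); exact: measurable_tnth. Qed.

Lemma integral_lebesgue_tuple_prod (phi : R -> R) d :
  measurable_fun setT phi -> (forall x, 0 <= phi x) ->
  (\int[lebesgue_measure]_x (phi x)%:E = 1)%E ->
  (\int[lebesgue_tuple d]_x (\prod_(i < d) phi (tnth x i))%:E = 1)%E.
Proof.
move=> mphi phi0 phi1; elim: d => [|d IH].
  rewrite integral_dirac//=; last first.
    by apply/measurable_EFinP; apply: measurable_prod => i _; exact: measurable_tnth_fun.
  by rewrite diracT mul1e big_ord0.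
have mprod n : measurable_fun setT (fun x : n.-tuple T => \prod_(i < n) phi (tnth x i)).
  by apply: measurable_prod => i _; exact: measurable_tnth_fun.
have prod0 n (x : n.-tuple T) : 0 <= \prod_(i < n) phi (tnth x i).
  exact: prodr_ge0.
transitivity (\int[pushforward (@lebesgue_measure R \x lebesgue_tuple d)%E (@tcons R d)]_x
   (\prod_(i < d.+1) phi (tnth x i))%:E)%E; first by [].
rewrite (ge0_integral_pushforward (@measurable_tcons R d))//; last 2 first.
- by apply/measurable_EFinP; exact: (mprod d.+1).
- by move=> x _; rewrite lee_fin; exact: (prod0 d.+1).
rewrite preimage_setT /=.
transitivity (\int[@lebesgue_measure R \x lebesgue_tuple d]_u
    (phi u.1 * \prod_(i < d) phi (tnth u.2 i))%:E)%E.
  apply: eq_integral => u _ /=; rewrite big_ord_recl /=; congr (_ * _)%:E.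
  by apply: eq_bigr => i _; rewrite tnthS.
have m2 : measurable_fun setT
    (fun u : T * d.-tuple T => phi u.1 * \prod_(i < d) phi (tnth u.2 i)).
  apply: measurable_funM; first exact: measurableT_comp.
  exact: (measurableT_comp (mprod d) measurable_snd).
rewrite fubini_tonelli1//=; last 2 first.
- exact/measurable_EFinP.
- by move=> u; rewrite lee_fin; apply: mulr_ge0 => //; exact: prod0.
rewrite -[RHS]phi1; apply: eq_integral => a _ /=.
transitivity ((phi a)%:E * \int[lebesgue_tuple d]_y (\prod_(i < d) phi (tnth y i))%:E)%E.
  by rewrite /fubini_F /=; exact: (ge0_integralZl_EFin_fun _ (phi0 a) (mprod d) (prod0 d)).
by rewrite IH mule1.
Qed.

Lemma heat_kernel_ge0 d (r : R) (x : d.-tuple T) : 0 <= heat_kernel r x.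
Proof.
by rewrite /heat_kernel; case: ifP => // _; rewrite mulr_ge0 ?powR_ge0 ?expR_ge0.
Qed.

(** Independent centred normal coordinates of variance 2 r; this reduces the total mass to dimension
    one. *)
Lemma heat_kernel_normal_pdf d (r : R) (x : d.-tuple T) : 0 < r ->
  heat_kernel r x = \prod_(i < d) normal_pdf 0 (Num.sqrt (2 * r)) (tnth x i : R).
Proof.
move=> r0; rewrite /heat_kernel r0.
have pr0 : 0 < 4 * pi * r by rewrite !mulr_gt0// pi_gt0.
have s0 : Num.sqrt (2 * r) != 0 by rewrite gt_eqF// sqrtr_gt0 mulr_gt0.
have -> : \prod_(i < d) normal_pdf 0 (Num.sqrt (2 * r)) (tnth x i : R) =
    \prod_(i < d) ((Num.sqrt (4 * pi * r))^-1 * expR (- (tnth x i : R) ^+ 2 / (4 * r))).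
  apply: eq_bigr => i _.
  rewrite normal_pdfE// /normal_peak /normal_fun subr0 sqr_sqrtr ?mulr_ge0 ?(ltW r0)//.
  by congr ((Num.sqrt _)^-1 * expR (_ / _)); ring.
rewrite big_split/= -expR_sum; congr (_ * expR _).
  rewrite prodr_const card_ord -powR12_sqrt ?(ltW pr0)// -powRN.
  rewrite -powR_mulrn ?powR_ge0// -powRrM.
  by congr (_ `^ _); ring.
by rewrite mulNr mulr_suml -sumrN; apply: eq_bigr => i _; rewrite mulNr.
Qed.

Lemma integral_heat_kernel d (r : R) : 0 < r ->
  (\int[lebesgue_tuple d]_x (heat_kernel r x)%:E = 1)%E.
Proof.
move=> r0; under eq_integral do rewrite heat_kernel_normal_pdf//.
apply: integral_lebesgue_tuple_prod.
- exact: measurable_normal_pdf.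
- by move=> x; exact: normal_pdf_ge0.
- exact: integral_normal_pdf.
Qed.

Lemma heat_kernel_tsub0 d (r : R) (x : d.-tuple T) :
  heat_kernel r (tsub [tuple of nseq d 0] x) = heat_kernel r x.
Proof.
have sumE : \sum_(i < d) (tnth (tsub [tuple of nseq d 0] x) i : R) ^+ 2 =
    \sum_(i < d) (tnth x i : R) ^+ 2.
  by apply: eq_bigr => i _; rewrite tnth_mktuple tnth_nseq sub0r sqrrN.
by rewrite /heat_kernel sumE.
Qed.

Lemma heat_kernel_le d (r : R) (x : d.-tuple T) : 0 < r ->
  heat_kernel r x <= (4 * pi * r) `^ (- (d%:R / 2)).
Proof.
move=> r0; rewrite /heat_kernel r0 ler_piMr ?powR_ge0//.
rewrite -expR0 ler_expR mulNr oppr_le0 divr_ge0 ?mulr_ge0 ?(ltW r0)//.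
by apply: sumr_ge0 => i _; exact: sqr_ge0.
Qed.

(** [q] factors are bounded by the supremum and one is kept, to be integrated to 1 in space. *)
Lemma heat_kernel_powR_le d (r q : R) (x : d.-tuple T) : 0 < r -> 0 < q ->
  heat_kernel r x `^ (q + 1) <= (4 * pi * r) `^ (- (d%:R * q / 2)) * heat_kernel r x.
Proof.
move=> r0 q0; rewrite powRD1 ?heat_kernel_ge0// ler_wpM2r ?heat_kernel_ge0//.
rewrite [leRHS](_ : _ = ((4 * pi * r) `^ (- (d%:R / 2))) `^ q); last first.
  by rewrite -powRrM; congr (_ `^ _); ring.
rewrite ge0_ler_powR ?nnegrE ?heat_kernel_ge0 ?powR_ge0 ?(ltW q0)//.
exact: heat_kernel_le.
Qed.

Lemma measurable_heat_kernel d (t : R) :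
  measurable_fun setT (fun u : T * d.-tuple T => heat_kernel (t - (u.1 : R)) u.2).
Proof.
have m1 : measurable_fun setT (fun u : T * d.-tuple T => t - (u.1 : R)).
  by apply: measurable_funB => //; exact: measurable_fst.
(* The division is written as a power with exponent -1, so that measurability follows from that of
   [powR]. *)
pose g (u : T * d.-tuple T) : R := if 0 < t - (u.1 : R) then
    (4 * pi * (t - (u.1 : R))) `^ (- (d%:R / 2)) *
    expR (- (\sum_(i < d) (tnth u.2 i : R) ^+ 2) * (4 * (t - (u.1 : R))) `^ (-1))
  else 0.
rewrite (_ : (fun u => _) = g); last first.
  apply/funext => u; rewrite /g /heat_kernel; case: ifPn => // u0.
  by rewrite powR_inv1// mulr_ge0// ltW.
apply: measurable_fun_ifT => //; first exact: measurable_fun_ltr.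
apply: measurable_funM.
  by apply: measurable_fun_powR; exact: measurable_funM.
apply: (measurableT_comp (@measurable_expR R)); apply: measurable_funM.
  apply: measurableT_comp => //; apply: measurable_sum => i.
  apply: measurable_funX.
  exact: (measurableT_comp (measurable_tnth i) measurable_snd).
by apply: measurable_fun_powR; exact: measurable_funM.
Qed.

End product_integral.

Section time_integral.
Context {R : realType}.
Local Notation leb := (@lebesgue_measure R).

Let is_derive_powR_sub (t e s : R) : s < t ->
  is_derive s 1 (fun x => (t - x) `^ e) (- (e * (t - s) `^ (e - 1))).
Proof.
move=> st; have ts0 : 0 < t - s by rewrite subr_gt0.
have d1 : is_derive s 1 (fun x : R => t - x) (-1).
  by rewrite -[X in is_derive _ _ _ X]sub0r; apply: is_deriveB.
have := @is_derive1_comp R (@powR R ^~ e) (fun x => t - x) s _ _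
  (is_derive1_powR e ts0) d1.
by rewrite mulrN1.
Qed.

Let integral_powR_sub_le (t b e : R) : 0 < b -> b < t -> 0 < e <= 1 ->
  (\int[leb]_(s in `[0%R, b]) ((t - s) `^ (e - 1))%:E <= (e^-1 * t `^ e)%:E)%E.
Proof.
move=> b0 bt /andP[e0 e1].
pose F (s : R) := - e^-1 * (t - s) `^ e.
have dF s : s < t -> is_derive s 1 F ((t - s) `^ (e - 1)).
  move=> st.
  have h := is_derive_powR_sub e st.
  have -> : (t - s) `^ (e - 1) = - e^-1 * (- (e * (t - s) `^ (e - 1))).
    by rewrite mulrNN mulrA mulVf ?mul1r// gt_eqF.
  exact: is_deriveZ.
have cF s : s < t -> {for s, continuous F}.
  move=> /dF [dF' _]; apply/differentiable_continuous.
  exact/derivable1_diffP.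
rewrite (@continuous_FTC2 _ _ F)//.
- rewrite -EFinB lee_fin /F subr0.
  have : 0 <= e^-1 * (t - b) `^ e by rewrite mulr_ge0 ?powR_ge0// invr_ge0 ltW.
  lra.
- apply: continuous_in_subspaceT => s /[!inE] /=; rewrite in_itv/= => /andP[_ sb].
  apply/differentiable_continuous/derivable1_diffP.
  by case: (is_derive_powR_sub (e - 1) (le_lt_trans sb bt)).
- split.
  + move=> s; rewrite in_itv/= => /andP[_ sb].
    by case: (dF s (lt_trans sb bt)).
  + by apply: cvg_at_right_filter; apply: cF; exact: lt_trans bt.
  + by apply: cvg_at_left_filter; exact: cF.
- move=> s; rewrite in_itv/= => /andP[_ sb]; rewrite derive1E.
  by case: (dF s (lt_trans sb bt)).
Qed.

(** The integrand may blow up at s = t: the antiderivative is used on [0, b n] with b n < t, and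
    Fatou's lemma reaches the endpoint. *)
Lemma integral_time_powR_le (t e : R) : 0 < t -> 0 < e <= 1 ->
  (\int[leb]_s (if 0 < s < t then (t - s) `^ (e - 1) else 0)%:E
    <= (e^-1 * t `^ e)%:E)%E.
Proof.
move=> t0 e01; pose b n := t - t / n.+2%:R.
have b0 n : 0 < b n.
  by rewrite subr_gt0 ltr_pdivrMr// ltr_pMr// ltr1n.
have bt n : b n < t by rewrite ltrBlDr ltrDl divr_gt0.
have mt : measurable_fun setT (fun s : R => (t - s) `^ (e - 1)).
  by apply: measurable_fun_powR; exact: measurable_funB.
apply: (@fatou_bound _ _ _ leb _
  (fun n s => if 0 <= s <= b n then (t - s) `^ (e - 1) else 0)).
- apply: measurable_fun_ifT => //; apply: measurable_and => //.
  + exact: measurable_fun_ltr.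
  + exact: measurable_fun_ltr.
- by move=> s; case: ifP => // _; exact: powR_ge0.
- move=> n; apply: measurable_fun_ifT => //; apply: measurable_and => //.
  + exact: measurable_fun_ler.
  + exact: measurable_fun_ler.
- by move=> n s; case: ifP => // _; exact: powR_ge0.
- move=> s; case: ifPn => [/andP[s0 st]|_]; [right|by left].
  apply: cvg_near_cst; near=> n; rewrite ifT// ltW//=.
  rewrite /b lerBrDr -lerBrDl ler_pdivrMr// mulrC -ler_pdivrMr ?subr_gt0//.
  apply: (@le_trans _ _ n%:R); last by rewrite ler_nat leqW// leqW.
  by near: n; exact: nbhs_infty_ger.
- move=> n; apply: le_trans (integral_powR_sub_le (b0 n) (bt n) e01).
  rewrite [leRHS]integral_mkcond le_eqVlt; apply/orP; left; apply/eqP.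
  apply: eq_integral => s _; rewrite patchE; case: ifPn => sb.
    by rewrite ifT// inE/= in_itv.
  by rewrite ifF//; apply/negbTE; rewrite notin_setE/= in_itv; exact/negP.
Unshelve. all: by end_near. Qed.

Lemma integral_time_cst (t : R) : 0 < t ->
  (\int[leb]_s (if (0 < s < t)%R then 1 else 0)%:E = t%:E)%E.
Proof.
move=> t0; transitivity (\int[leb]_s (\1_`]0%R, t[%classic s)%:E)%E.
  apply: eq_integral => s _; rewrite indicE; congr EFin.
  case: ifPn => st; first by rewrite mem_set//= in_itv.
  by rewrite memNset//= in_itv/=; exact/negP.
transitivity (leb `]0%R, t[%classic); first by rewrite integral_indic// setIT.
by rewrite lebesgue_measure_itv/= lte_fin t0 oppr0 adde0.
Qed.

End time_integral.

(** * The intensity of the noise *)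

Section levy_measure_sigma_finite.
Context {R : realType} (lambda : {measure set (measurableTypeR R) -> \bar R}).

(** By Markov's inequality each set |z| >= 1 / (n + 1) has finite mass; with the null set {0} these
    exhaust the line. *)
Lemma integrable_norm_sigma_finite :
  lambda [set 0] = 0%E -> (\int[lambda]_z `|(z : R)|%:E < +oo)%E ->
  sigma_finite setT lambda.
Proof.
move=> l0 l1.
have mid : measurable_fun setT (fun z : measurableTypeR R => (z : R)%:E).
  exact/measurable_EFinP.
pose A n : set (measurableTypeR R) := setT `&` [set z | (n.+1%:R^-1%:E <= `|(z : R)%:E|)%E].
have mA n : measurable (A n).
  by apply: emeasurable_fun_c_infty => //; exact: measurableT_comp.
have Aoo n : (lambda (A n) < +oo)%E.
  have := le_integral_abse lambda measurableT mid (a := n.+1%:R^-1).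
  rewrite invr_gt0 ltr0n => /(_ isT) h.
  rewrite ltey; apply: contraTneq h => ->.
  by rewrite gt0_muley ?lte_fin// leye_eq lt_eqF.
exists (fun n => [set 0] `|` A n).
  apply/seteqP; split => // z _; have [->|z0] := eqVneq (z : R) 0; first by exists 0%N => //; left.
  exists (Num.truncn `|(z : R)|^-1) => //; right; split => //=.
  rewrite lee_fin -[leRHS]invrK lef_pV2 ?posrE ?invr_gt0 ?normr_gt0//.
  by apply/ltW/truncnS_gt.
move=> n; split; first exact: measurableU.
apply: le_lt_trans (measureU2 _ _ _) _ => //.
by have := Aoo n; rewrite -[X in (X < _)%E -> _]add0e -l0.
Qed.

End levy_measure_sigma_finite.

Section noise.
Context {R : realType} (d : nat).
Local Notation T := (measurableTypeR R).
Local Notation E := ((T * d.-tuple T) * T)%type.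

Lemma measurable_positive_time : measurable [set v : E | 0 < (v.1.1 : R)].
Proof.
rewrite -[X in measurable X]setTI.
apply: (@measurable_fun_ltr _ _ _ setT (fun=> 0) (fun v : E => v.1.1 : R)) => //.
by apply: (measurableT_comp measurable_fst); exact: measurable_fst.
Qed.

(** [noise_intensity] packaged as a measure; the two are convertible, so the Poisson hypothesis
    transfers unchanged. *)
Definition noise_measure (lambda : {measure set T -> \bar R}) :=
  mrestr (lebesgue_spacetime d \x^ lambda)%E measurable_positive_time.

HB.instance Definition _ (lambda : {measure set T -> \bar R}) :=
  Measure.on (noise_measure lambda).

Lemma integral_noise_measure (lambda : {sigma_finite_measure set T -> \bar R})
    (G : T * d.-tuple T -> R) (k : R -> R) :
  measurable_fun setT G -> (forall u, 0 <= G u) ->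
  (forall u, (u.1 : R) <= 0 -> G u = 0) ->
  measurable_fun setT k -> (forall z, 0 <= k z) ->
  (\int[noise_measure lambda]_v (G v.1 * k v.2)%:E =
   (\int[lebesgue_measure]_s \int[lebesgue_tuple d]_y (G (s, y))%:E) *
   \int[lambda]_z (k z)%:E)%E.
Proof.
move=> mG G0 Gneg mk k0.
have mF : measurable_fun setT (fun v : E => G v.1 * k v.2).
  apply: measurable_funM; first exact: (measurableT_comp mG measurable_fst).
  exact: (measurableT_comp mk measurable_snd).
have mF' : measurable_fun setT (fun v : E => (G v.1 * k v.2)%:E).
  exact/measurable_EFinP.
rewrite /noise_measure ge0_integral_mrestr//; last 2 first.
- by move=> v; rewrite mulr_ge0.
- by move=> v /negP; rewrite -leNgt => /Gneg ->; rewrite mul0r.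
rewrite ge0_integral_product_measure2 fubini_tonelli2//; last first.
  by move=> v; rewrite lee_fin mulr_ge0.
transitivity (\int[lambda]_z ((\int[lebesgue_spacetime d]_u (G u)%:E) * (k z)%:E))%E.
  apply: eq_integral => z _; rewrite /fubini_G /= muleC.
  rewrite -(ge0_integralZl_EFin_fun _ (k0 z) mG G0).
  by apply: eq_integral => u _; rewrite mulrC.
rewrite ge0_integralZl//; last 3 first.
- exact/measurable_EFinP.
- by move=> z _; rewrite lee_fin.
- by apply: integral_ge0 => u _; rewrite lee_fin.
congr (_ * _)%E; rewrite /lebesgue_spacetime fubini_tonelli1//.
exact/measurable_EFinP.
Qed.

End noise.

Section heat_source.
Context {R : realType} (d : nat).
Local Notation T := (measurableTypeR R).

(** The integrand of the solution at x = 0, extended by 0 to all times: the cut at 0 is explicit,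
    the one at [t] is that of [heat_kernel]. *)
Definition heat_source (t : R) (u : T * d.-tuple T) : R :=
  if 0 < (u.1 : R) then heat_kernel (t - (u.1 : R)) u.2 else 0.

Lemma heat_source_ge0 t u : 0 <= heat_source t u.
Proof. by rewrite /heat_source; case: ifP => // _; exact: heat_kernel_ge0. Qed.

Lemma heat_source_neg t u : (u.1 : R) <= 0 -> heat_source t u = 0.
Proof. by rewrite /heat_source ltNge => ->. Qed.

Lemma heat_source_notin t u : ~~ (0 < (u.1 : R) < t) -> heat_source t u = 0.
Proof.
rewrite negb_and /heat_source => /orP[/negbTE ->//|]; case: ifP => // _.
by rewrite /heat_kernel subr_gt0 => /negbTE ->.
Qed.

Lemma measurable_heat_source t : measurable_fun setT (heat_source t).
Proof.
apply: measurable_fun_ifT => //; last exact: measurable_heat_kernel.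
by apply: measurable_fun_ltr => //; exact: measurable_fst.
Qed.

Lemma integral_heat_source (t : R) : 0 < t ->
  (\int[lebesgue_measure]_s \int[lebesgue_tuple d]_y (heat_source t (s, y))%:E
   = t%:E)%E.
Proof.
move=> t0; rewrite -[RHS]integral_time_cst//; apply: eq_integral => s _.
case: ifPn => [/andP[s0 st]|st].
  rewrite -[RHS](@integral_heat_kernel R d (t - s)) ?subr_gt0//.
  by apply: eq_integral => y _; rewrite /heat_source/= s0.
by apply: integral0_eq => y _; rewrite heat_source_notin.
Qed.

(** The restriction p < 1 + 2/d enters here: with p = q + 1, the singularity (t - s)^(-d q / 2) is
    integrable at s = t exactly when d q / 2 < 1. *)
Lemma integral_heat_source_powR_le (t q : R) : 0 < t -> 0 < q -> d%:R * q / 2 < 1 ->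
  (\int[lebesgue_measure]_s \int[lebesgue_tuple d]_y (heat_source t (s, y) `^ (q + 1))%:E
   <= ((1 - d%:R * q / 2)^-1 * t `^ (1 - d%:R * q / 2))%:E)%E.
Proof.
move=> t0 q0 dq1; set e := 1 - _.
have dq0 : 0 <= d%:R * q / 2 by rewrite divr_ge0// mulr_ge0 ?ler0n// ltW.
have e01 : 0 < e <= 1 by rewrite /e subr_gt0 dq1/= gerBl.
apply: le_trans (integral_time_powR_le t0 e01).
have mh r : 0 < r -> measurable_fun setT (fun y : d.-tuple T => heat_kernel r y).
  move=> r0; rewrite (_ : (fun y => _) = (fun y : d.-tuple T =>
      \prod_(i < d) normal_pdf 0 (Num.sqrt (2 * r)) (tnth y i : R))); last first.
    by apply/funext => y; exact: heat_kernel_normal_pdf.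
  apply: measurable_prod => i _; apply: measurable_tnth_fun.
  exact: measurable_normal_pdf.
have msource : measurable_fun setT
    (fun u : T * d.-tuple T => (heat_source t u `^ (q + 1))%:E).
  apply/measurable_EFinP; apply: measurable_fun_powR.
  exact: measurable_heat_source.
apply: ge0_le_integral => //.
- by move=> s _; apply: integral_ge0 => y _; rewrite lee_fin powR_ge0.
- have source0 (u : T * d.-tuple T) : (0 <= (heat_source t u `^ (q + 1))%:E)%E.
    by rewrite lee_fin powR_ge0.
  exact: (measurable_fun_fubini_tonelli_F (m2 := lebesgue_tuple d) _ msource source0).
- apply/measurable_EFinP; apply: measurable_fun_ifT => //.
    by apply: measurable_and; exact: measurable_fun_ltr.
  by apply: measurable_fun_powR; exact: measurable_funB.
move=> s _; case: ifPn => [/andP[s0 st]|st]; last first.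
  rewrite integral0_eq// => y _; rewrite heat_source_notin// powR0//.
  by rewrite gt_eqF// addr_gt0.
have ts0 : 0 < t - s by rewrite subr_gt0.
apply: (@le_trans _ _ (\int[lebesgue_tuple d]_y
   ((t - s) `^ (e - 1) * heat_kernel (t - s) y)%:E)%E).
  apply: ge0_le_integral_EFin.
  - by apply: measurable_fun_powR; rewrite /heat_source/= s0; exact: mh ts0.
  - by apply: measurable_funM => //; exact: mh ts0.
  - by move=> y; exact: powR_ge0.
  - move=> y; rewrite /heat_source/= s0.
    apply: le_trans (heat_kernel_powR_le _ ts0 q0) _.
    rewrite ler_wpM2r ?heat_kernel_ge0//.
    have -> : e - 1 = - (d%:R * q / 2) by rewrite /e; ring.
    rewrite !powRN lef_pV2 ?posrE ?powR_gt0 ?mulr_gt0 ?pi_gt0//.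
    rewrite ge0_ler_powR ?dq0 ?nnegrE ?mulr_ge0 ?pi_ge0 ?(ltW ts0)//.
    by rewrite ler_peMl ?(ltW ts0)//; have := pi_ge2 R; lra.
rewrite ge0_integralZl_EFin_fun ?powR_ge0//.
- by rewrite integral_heat_kernel// mule1.
- exact: mh ts0.
- by move=> y; exact: heat_kernel_ge0.
Qed.

End heat_source.

(** * Law of large numbers for jumps of one sign *)

Section heat_noise_lln.
Context {R : realType} (d : nat).
Local Notation T := (measurableTypeR R).
Local Notation E := ((T * d.-tuple T) * T)%type.
Context dO (Omega : measurableType dO) (P : probability Omega R).
Variables (N : Omega -> {measure set E -> \bar R})
  (lambda : {sigma_finite_measure set T -> \bar R}).
Hypothesis hN : is_poisson_random_measure P N (noise_measure (d := d) lambda).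

Definition noise_fun (t : R) (k : R -> R) (v : E) : R := heat_source t v.1 * k v.2.

Lemma measurable_noise_fun t k : measurable_fun setT k ->
  measurable_fun setT (noise_fun t k).
Proof.
move=> mk; apply: measurable_funM.
  exact: (measurableT_comp (measurable_heat_source t) measurable_fst).
exact: (measurableT_comp mk measurable_snd).
Qed.

Lemma noise_fun_ge0 t k v : (forall z, 0 <= k z) -> 0 <= noise_fun t k v.
Proof. by move=> k0; rewrite mulr_ge0 ?heat_source_ge0. Qed.

Lemma integral_noise_fun t (k : R -> R) b : 0 < t -> measurable_fun setT k ->
  (forall z, 0 <= k z) -> (\int[lambda]_z (k z)%:E = b%:E)%E ->
  (\int[noise_measure lambda]_v (noise_fun t k v)%:E = (b * t)%:E)%E.
Proof.
move=> t0 mk k0 kb; rewrite /noise_fun integral_noise_measure//.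
- by rewrite integral_heat_source// kb -EFinM mulrC.
- exact: measurable_heat_source.
- by move=> u; exact: heat_source_ge0.
- by move=> u; exact: heat_source_neg.
Qed.

Lemma integral_noise_fun_powR_le t (k : R -> R) q Q : 0 < t -> 0 < q ->
  d%:R * q / 2 < 1 -> measurable_fun setT k -> (forall z, 0 <= k z) ->
  (\int[lambda]_z (k z `^ (q + 1))%:E <= Q%:E)%E ->
  (\int[noise_measure lambda]_v (noise_fun t k v `^ (q + 1))%:E <=
   ((1 - d%:R * q / 2)^-1 * t `^ (1 - d%:R * q / 2) * Q)%:E)%E.
Proof.
move=> t0 q0 dq1 mk k0 kQ.
have -> : (\int[noise_measure lambda]_v (noise_fun t k v `^ (q + 1))%:E =
    \int[noise_measure (d := d) lambda]_v (heat_source t v.1 `^ (q + 1) * k v.2 `^ (q + 1))%:E)%E.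
  by apply: eq_integral => v _; rewrite /noise_fun powRM ?heat_source_ge0.
rewrite (integral_noise_measure lambda (G := fun u => heat_source t u `^ (q + 1))
    (k := fun z => k z `^ (q + 1)))//.
- rewrite EFinM; apply: lee_pmul => //.
  + by apply: integral_ge0 => s _; apply: integral_ge0 => y _; rewrite lee_fin powR_ge0.
  + by apply: integral_ge0 => z _; rewrite lee_fin powR_ge0.
  + exact: integral_heat_source_powR_le.
- by apply: measurable_fun_powR; exact: measurable_heat_source.
- by move=> u; exact: powR_ge0.
- by move=> u u0; rewrite heat_source_neg// powR0// gt_eqF// addr_gt0.
- exact: measurable_fun_powR.
- by move=> z; exact: powR_ge0.
Qed.

Lemma noise_fun_lln (k : R -> R) b q Q e : (0 < d)%N -> 0 < q ->
  d%:R * q / 2 < 1 -> measurable_fun setT k -> (forall z, 0 <= k z) ->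
  (\int[lambda]_z (k z)%:E = b%:E)%E ->
  (\int[lambda]_z (k z `^ (q + 1))%:E <= Q%:E)%E -> 0 < e ->
  \forall t \near +oo%R,
  (\int[P]_w (`|poisson_integral N (noise_fun t k) w / t - b| `^ (q + 1))%:E <= e%:E)%E.
Proof.
move=> d0 q0 dq1 mk k0 kb kQ e0.
have Q0 : 0 <= Q.
  rewrite -lee_fin; apply: le_trans kQ.
  by apply: integral_ge0 => z _; rewrite lee_fin powR_ge0.
set del := d%:R * q / 2 in dq1.
have del0 : 0 < del by rewrite /del !mulr_gt0// ltr0n.
have B1 : 1 <= Num.max b 1 by rewrite le_max lexx orbT.
have [C [C0 lln]] := poisson_integral_lln hN q0 B1.
pose r := (8 * (q + 1))^-1.
have r0 : 0 < r by rewrite invr_gt0 mulr_gt0// addr_gt0.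
(* For theta = c t^(-del), the second entry gives the bound on the moment of order q + 1 and the
   first gives 1 / t <= theta, because del < 1. *)
pose c := Num.max 1 ((1 - del)^-1 * Q).
have c1 : 1 <= c by rewrite le_max lexx.
have c0 : 0 < c by exact: lt_le_trans c1.
(* theta <= tau ensures theta <= 1 and C theta^r <= C e / (C + 1) <= e; adding 1 covers [C = 0]. *)
pose tau := Num.min 1 ((e / (C + 1)) `^ r^-1).
have tau0 : 0 < tau.
  by rewrite lt_min ltr01 powR_gt0// divr_gt0// ltr_pwDr.
near=> t.
have t1 : 1 <= t by near: t; exact: nbhs_pinfty_ge.
have t0 : 0 < t by exact: lt_le_trans t1.
(* The inequality c t^(-del) <= tau, solved for [t]. *)
have tge : (tau^-1 * c) `^ del^-1 <= t.
  by near: t; apply: nbhs_pinfty_ge; exact: num_real.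
pose theta := c * t `^ (- del).
have theta0 : 0 < theta by rewrite mulr_gt0// powR_gt0.
have theta_tau : theta <= tau.
  rewrite /theta powRN ler_pdivrMr ?powR_gt0// -ler_pdivrMl//.
  have tc0 : 0 <= tau^-1 * c by rewrite mulr_ge0 ?invr_ge0 ?(ltW tau0) ?(ltW c0).
  have : ((tau^-1 * c) `^ del^-1) `^ del <= t `^ del.
    by apply: ge0_ler_powR => //; rewrite ?nnegrE ?powR_ge0// ltW.
  by rewrite -powRrM mulVf ?powRr1// gt_eqF.
have theta1 : theta <= 1 by apply: le_trans theta_tau _; rewrite ge_min lexx.
have tV : t `^ (- del) * t = t `^ (1 - del).
  rewrite -[X in _ * X = _]powRr1 ?(ltW t0)// -powRD; last first.
    by rewrite (gt_eqF t0) implybT.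
  by rewrite addrC.
apply: (@le_trans _ _ (C * theta `^ r)%:E).
  apply: lln.
  - exact: measurable_noise_fun.
  - by move=> v; exact: noise_fun_ge0.
  - exact: t1.
  - by rewrite theta0.
  - apply: (@le_trans _ _ (t `^ (- del))); last by rewrite ler_peMl ?powR_ge0.
    by rewrite -powR_inv1 ?(ltW t0)// ler_powR// lerN2 ltW.
  - by rewrite le_max lexx.
  - exact: integral_noise_fun.
  - apply: le_trans (integral_noise_fun_powR_le t0 q0 dq1 mk k0 kQ) _.
    rewrite lee_fin -/del -mulrA [_ `^ _ * Q]mulrC mulrA /theta -[leRHS]mulrA tV.
    by rewrite ler_wpM2r ?powR_ge0// le_max lexx orbT.
rewrite lee_fin.
have thr : theta `^ r <= e / (C + 1).
  apply: (@le_trans _ _ (((e / (C + 1)) `^ r^-1) `^ r)).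
    rewrite ge0_ler_powR ?nnegrE ?powR_ge0 ?(ltW r0) ?(ltW theta0)//.
    by apply: le_trans theta_tau _; rewrite ge_min lexx orbT.
  have eC0 : 0 <= e / (C + 1) by apply: divr_ge0; [exact: ltW|exact: addr_ge0].
  by rewrite -powRrM mulVf ?powRr1// gt_eqF.
apply: (@le_trans _ _ (C * (e / (C + 1)))); first by rewrite ler_wpM2l.
by rewrite mulrCA ler_piMr ?(ltW e0)// ler_pdivrMr ?mul1r ?lerDl// ltr_pwDr.
Unshelve. all: by end_near. Qed.

End heat_noise_lln.

(* Carries [m] together with a proof of sigma-finiteness, so that Tonelli's theorem,
   stated for bundled sigma-finite measures, applies to the bare measure of the
   statement. *)
Section sigma_finite_copy.
Context d (T : measurableType d) (R : realType) (m : {measure set T -> \bar R}).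

Definition sigma_finite_copy of sigma_finite setT m : set T -> \bar R := m.

Variable (msf : sigma_finite setT m).

HB.instance Definition _ := Measure.on (sigma_finite_copy msf).
HB.instance Definition _ :=
  Measure_isSigmaFinite.Build _ _ _ (sigma_finite_copy msf) msf.

End sigma_finite_copy.

(** * The mild solution *)

Section mild_solution.
Context {R : realType} (d : nat).
Local Notation T := (measurableTypeR R).
Local Notation E := ((T * d.-tuple T) * T)%type.

Lemma Rintegral_heat_kernel_spacetime (t : R) : 0 < t ->
  \int[lebesgue_spacetime d]_(u in [set u : T * d.-tuple T | 0 < (u.1 : R) <= t])
    heat_kernel (t - (u.1 : R)) (tsub [tuple of nseq d 0] u.2) = t.
Proof.
move=> t0; rewrite /Rintegral integral_mkcond.
rewrite (eq_integral (fun u => (heat_source t u)%:E)); last first.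
  move=> [s y] _; rewrite patchE; case: ifPn => [|/negP sy].
    by rewrite inE/= => /andP[s0 st]; rewrite heat_kernel_tsub0 /heat_source/= s0.
  rewrite heat_source_notin//=; apply/negP => /andP[s0 st]; apply: sy.
  by rewrite inE/= s0 ltW.
rewrite /lebesgue_spacetime fubini_tonelli1//.
- by rewrite [X in fine X](integral_heat_source d t0).
- by apply/measurable_EFinP; exact: measurable_heat_source.
- by move=> u; rewrite lee_fin heat_source_ge0.
Qed.

(** Valid for every [mu], even without integrability: the integral is by definition the difference
    of those of the positive and negative parts, and the kernel, being nonnegative, leaves the sign
    to the jump. *)
Lemma mild_solution_noise_fun (m0 t : R) (mu : {measure set E -> \bar R}) : 0 < t ->
  mild_solution m0 mu t [tuple of nseq d 0] = m0 * t +
    fine (\int[mu]_v (noise_fun t (fun z => Num.max z 0) v)%:E -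
          \int[mu]_v (noise_fun t (fun z => Num.max (- z) 0) v)%:E)%E.
Proof.
move=> t0; rewrite /mild_solution /noise_integral Rintegral_heat_kernel_spacetime//.
congr (_ + _); rewrite /Rintegral integralE.
have hsE (v : E) : v \in [set u : T * d.-tuple T | 0 < (u.1 : R) <= t] `*` setT ->
    heat_kernel (t - (v.1.1 : R)) (tsub [tuple of nseq d 0] v.1.2) = heat_source t v.1.
  by rewrite inE => -[/= /andP[s0 st] _]; rewrite heat_kernel_tsub0 /heat_source s0.
have hs0 (v : E) : v \notin [set u : T * d.-tuple T | 0 < (u.1 : R) <= t] `*` setT ->
    heat_source t v.1 = 0.
  move=> /negP sy; rewrite heat_source_notin//; apply/negP => /andP[s0 st]; apply: sy.
  by rewrite inE/=; split => //=; rewrite s0 ltW.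
congr (fine (_ - _)%E); rewrite integral_mkcond; apply: eq_integral => v _;
  rewrite patchE /noise_fun; case: ifPn => [vD|/hs0 ->]; rewrite ?mul0r//.
- rewrite funeposE hsE// -EFin_max maxr_pMr ?heat_source_ge0// mulr0.
  by [].
- rewrite funenegE hsE// -EFinN -EFin_max maxr_pMr ?heat_source_ge0// mulr0 mulrN.
  by [].
Qed.

End mild_solution.

(** * Comparison of exponents and conclusion *)

Lemma powR_le_add_powR {R : realType} (x a b c : R) : 0 <= x -> 0 < a -> a <= b -> b <= c ->
  x `^ b <= x `^ a + x `^ c.
Proof.
move=> x0 a0 ab bc; have [x1|/ltW x1] := leP x 1.
  have [->|xn0] := eqVneq x 0.
    by rewrite powR0 ?addr_ge0 ?powR_ge0// gt_eqF// (lt_le_trans a0).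
  by rewrite ler_wpDr ?powR_ge0// ger_powR// lt0r xn0 x0.
by rewrite ler_wpDl ?powR_ge0// ler_powR.
Qed.

(** Cut at h = eps^(1/p): below it x^p <= eps, above it x^(p' - p) >= h^(p' - p). On a probability
    space this lets convergence in L^p' imply convergence in L^p, also for p < 1. *)
Lemma powR_le_eps_powR {R : realType} (x p p' eps : R) : 0 <= x -> 0 < p -> p <= p' ->
  0 < eps ->
  x `^ p <= eps + ((eps `^ p^-1) `^ (p' - p))^-1 * x `^ p'.
Proof.
move=> x0 p0 pp' e0; set h := eps `^ p^-1.
have h0 : 0 < h by exact: powR_gt0.
have hp : h `^ p = eps by rewrite /h -powRrM mulVf ?powRr1 ?(ltW e0)// gt_eqF.
have K0 : 0 <= (h `^ (p' - p))^-1 by rewrite invr_ge0 powR_ge0.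
have [xh|hx] := leP x h.
  rewrite ler_wpDr ?mulr_ge0 ?powR_ge0// -hp ge0_ler_powR ?nnegrE ?(ltW p0)//.
  exact: ltW.
have x1 : 0 < x by exact: lt_trans hx.
rewrite ler_wpDl ?(ltW e0)// mulrC ler_pdivlMr ?powR_gt0//.
have -> : x `^ p' = x `^ p * x `^ (p' - p).
  by rewrite -powRD ?(gt_eqF x1) ?implybT//; congr (_ `^ _); ring.
rewrite ler_wpM2l ?powR_ge0// ge0_ler_powR ?nnegrE ?subr_ge0//; exact: ltW.
Qed.

Lemma integral_powR_norm_sub_le d (T : measurableType d) (R : realType)
    (mu : {measure set T -> \bar R}) (X X1 X2 : T -> R) (p e : R) : 0 < p ->
  measurable_fun setT X -> measurable_fun setT X1 -> measurable_fun setT X2 ->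
  {ae mu, forall w, X w = X1 w - X2 w} ->
  (\int[mu]_w (`|X1 w| `^ p)%:E <= e%:E)%E ->
  (\int[mu]_w (`|X2 w| `^ p)%:E <= e%:E)%E ->
  (\int[mu]_w (`|X w| `^ p)%:E <= (2 `^ p * (e + e))%:E)%E.
Proof.
move=> p0 mX mX1 mX2 XE I1 I2.
have mpow (Y : T -> R) : measurable_fun setT Y ->
    measurable_fun setT (fun w => `|Y w| `^ p).
  by move=> mY; apply: measurable_fun_powR; exact: measurableT_comp.
apply: (@le_trans _ _ (\int[mu]_w (2 `^ p * (`|X1 w| `^ p + `|X2 w| `^ p))%:E)%E).
  apply: ae_ge0_le_integral => //.
  - by apply/measurable_EFinP; exact: mpow.
  - apply/measurable_EFinP; apply: measurable_funM => //.
    by apply: measurable_funD; exact: mpow.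
  - apply: filterS XE => w -> _; rewrite lee_fin.
    apply: le_trans (powR_sum_le2 _ _ _) => //; last exact: ltW.
    rewrite ge0_ler_powR ?(ltW p0) ?nnegrE ?addr_ge0//.
    exact: ler_normB.
rewrite ge0_integralZl_EFin_fun ?powR_ge0//; last first.
  by apply: measurable_funD; exact: mpow.
rewrite ge0_integralD_EFin//; [|exact: mpow|exact: mpow].
by rewrite EFinM lee_wpmul2l ?lee_fin ?powR_ge0// EFinD leeD.
Qed.

Theorem theorem2p3 (R : realType) (d : nat) (hd : (1 <= d)%N)
    (dO : measure_display) (Omega : measurableType dO)
    (P : probability Omega R)
    (lambda : {measure set (measurableTypeR R) -> \bar R})
    (hlevy : is_levy_measure lambda)
    (hlambda0 : lambda setT <> 0%E)
    (hlambda1 : (\int[lambda]_z `|(z : R)|%:E < +oo)%E)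
    (tau : nat -> {RV P >-> measurableTypeR R})
    (eta : nat -> {RV P >-> d.-tuple (measurableTypeR R)})
    (zeta : nat -> {RV P >-> measurableTypeR R})
    (mu : Omega ->
      {measure set ((measurableTypeR R * d.-tuple (measurableTypeR R))
                    * measurableTypeR R) -> \bar R})
    (hmu : forall w, mu w = point_measure
             (fun i => tau i w) (fun i => eta i w) (fun i => zeta i w))
    (hprm : is_poisson_random_measure P mu (noise_intensity lambda))
    (m : R) (Y0 : R -> Omega -> R)
    (hY0 : forall t w,
       Y0 t w = mild_solution (noise_drift lambda m) (mu w) t [tuple of nseq d 0])
    (eps : R) (heps : 0 < eps)
    (hmoment : (\int[lambda]_z (`|(z : R)| `^ (1 + eps))%:E < +oo)%E)
    (hlog : (\int[lambda]_(z in `[(-1)%R, 1%R]%classic)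
               (`|(z : R) * ln `|z : R| |)%R%:E < +oo)%E)
    (p : R) (hp0 : 0 < p) (hp1 : p <= 1 + eps) (hp2 : p < 1 + 2 / d%:R) :
  ('E_P[fun w => (`|Y0 t w / t - m| `^ p)%R])%E @[t --> +oo%R] --> 0%E.
Proof.
have lsf : sigma_finite setT lambda.
  by apply: integrable_norm_sigma_finite => //; exact: hlevy.1.
pose l : {sigma_finite_measure set (measurableTypeR R) -> \bar R} :=
  sigma_finite_copy lsf.
have hN : is_poisson_random_measure P mu (noise_measure (d := d) l) by exact: hprm.
pose kp (z : R) := Num.max z 0; pose kn (z : R) := Num.max (- z) 0.
have kp0 z : 0 <= kp z by rewrite le_max lexx orbT.
have kn0 z : 0 <= kn z by rewrite le_max lexx orbT.
have kple z : kp z <= `|z| by rewrite ge_max ler_norm normr_ge0.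
have knle z : kn z <= `|z| by rewrite ge_max -normrN ler_norm normr_ge0.
have mkp : measurable_fun setT kp by exact: measurable_maxr.
have mkn : measurable_fun setT kn by exact: measurable_maxr.
have mnorm : measurable_fun setT (fun z : R => `|z|) by exact: measurableT_comp.
have kfin (k : R -> R) : measurable_fun setT k -> (forall z, 0 <= k z) ->
    (forall z, k z <= `|z|) ->
    (\int[l]_z (k z)%:E = (fine (\int[l]_z (k z)%:E))%:E)%E.
  move=> mk k0 kle; rewrite fineK// ge0_fin_numE.
    apply: le_lt_trans hlambda1; exact: (ge0_le_integral_EFin l mk mnorm k0 kle).
  by apply: integral_ge0 => z _; rewrite lee_fin.
have kpE := kfin _ mkp kp0 kple; have knE := kfin _ mkn kn0 knle.
set bp := fine _ in kpE; set bn := fine _ in knE.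
(* The drift removes the mean jump bp - bn, which the two Poisson integrals restore; hence the limit
   [m]. *)
have driftE : noise_drift lambda m = m - (bp - bn).
  rewrite /noise_drift /Rintegral integralE; congr (_ - _).
  rewrite -[RHS]/(fine (bp - bn)%:E); congr fine; rewrite EFinB -kpE -knE.
  congr (_ - _)%E; apply: eq_integral => z _.
  - by rewrite funeposE -EFin_max.
  - by rewrite funenegE -EFinN -EFin_max.
have d0 : 0 < d%:R :> R by rewrite ltr0n.
(* An admissible exponent q + 1 > 1 not below [p]. For p <= 1 the choice q <= 1/d gives d q / 2 <=
   1/2; for p > 1, q = p - 1 works by the bounds on [p]. *)
have [q [q0 dq1 pq qeps]] : exists q : R,
    [/\ 0 < q, d%:R * q / 2 < 1, p <= q + 1 & q <= eps].
  have [p1|p1] := leP p 1.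
    exists (Num.min eps d%:R^-1); split.
    - by rewrite lt_min heps invr_gt0.
    - rewrite (@le_lt_trans _ _ (d%:R * d%:R^-1 / 2))//; last first.
        by rewrite divff ?gt_eqF//; lra.
      by rewrite ler_pM2r ?ler_pM2l// ge_min lexx orbT.
    - by rewrite (le_trans p1)// lerDr le_min ltW// invr_ge0 ltW.
    - by rewrite ge_min lexx.
  exists (p - 1); split; [lra| |lra|lra].
  have : p - 1 < 2 / d%:R by lra.
  rewrite ltr_pdivlMr// => h; rewrite ltr_pdivrMr// mul1r mulrC; exact: h.
set p' := q + 1 in pq.
have p'0 : 0 < p' by rewrite addr_gt0.
(* As 1 <= q + 1 <= 1 + eps, |z|^(q + 1) <= |z| + |z|^(1 + eps), and both terms are integrable. *)
pose Q := fine (\int[lambda]_z (`|(z : R)|)%:E + \int[lambda]_z (`|(z : R)| `^ (1 + eps))%:E)%E.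
have kQ (k : R -> R) : measurable_fun setT k -> (forall z, 0 <= k z) ->
    (forall z, k z <= `|z|) -> (\int[l]_z (k z `^ (q + 1))%:E <= Q%:E)%E.
  move=> mk k0 kle.
  rewrite /Q fineK; last first.
    by rewrite fin_numD !ge0_fin_numE ?hlambda1//; apply: integral_ge0 => z _;
      rewrite lee_fin ?powR_ge0.
  rewrite -ge0_integralD_EFin//; last exact: measurable_fun_powR.
  apply: ge0_le_integral_EFin.
  - exact: measurable_fun_powR.
  - by apply: measurable_funD => //; exact: measurable_fun_powR.
  - by move=> z; exact: powR_ge0.
  - move=> z; apply: (@le_trans _ _ (`|z| `^ (q + 1))).
      by rewrite ge0_ler_powR ?nnegrE// ltW.
    rewrite -[X in _ <= X + _]powRr1//; apply: powR_le_add_powR => //; lra.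
have hp := noise_fun_lln hN hd q0 dq1 mkp kp0 kpE (kQ _ mkp kp0 kple).
have hn := noise_fun_lln hN hd q0 dq1 mkn kn0 knE (kQ _ mkn kn0 knle).
have YE (t : R) w : 0 < t -> Y0 t w = noise_drift lambda m * t +
    fine (\int[mu w]_v (noise_fun t kp v)%:E - \int[mu w]_v (noise_fun t kn v)%:E)%E.
  by move=> t0; rewrite hY0; exact: mild_solution_noise_fun.
have mJ t (k : R -> R) : measurable_fun setT k -> (forall z, 0 <= k z) ->
    measurable_fun setT (fun w => \int[mu w]_v (noise_fun (d := d) t k v)%:E)%E.
  move=> mk k0; apply: (measurable_integral_poisson hN).
  - by move=> v; exact: noise_fun_ge0.
  - exact: measurable_noise_fun.
have mY (t : R) : 0 < t -> measurable_fun setT (fun w => Y0 t w / t - m).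
  move=> t0; apply: measurable_funB => //; apply: measurable_funM => //.
  have -> : Y0 t = (fun w => noise_drift lambda m * t +
      fine (\int[mu w]_v (noise_fun t kp v)%:E - \int[mu w]_v (noise_fun t kn v)%:E)%E).
    by apply/funext => w; exact: YE.
  apply: measurable_funD => //; apply: measurableT_comp => //.
  by apply: emeasurable_funB; exact: mJ.
(* The two integrals can be separated under [fine] only where both are finite, which holds almost
   surely. *)
have Yae (t : R) : 0 < t -> {ae P, forall w, Y0 t w / t - m =
    (poisson_integral mu (noise_fun t kp) w / t - bp) -
    (poisson_integral mu (noise_fun t kn) w / t - bn)}.
  move=> t0.
  have Joo (k : R -> R) b : measurable_fun setT k -> (forall z, 0 <= k z) ->
      (\int[l]_z (k z)%:E = b%:E)%E ->
      {ae P, forall w, (\int[mu w]_v (noise_fun (d := d) t k v)%:E < +oo)%E}.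
    move=> mk k0 kb; apply: (poisson_integral_ae_lty hN).
    - by move=> v; exact: noise_fun_ge0.
    - exact: measurable_noise_fun.
    - by rewrite (integral_noise_fun d t0 mk k0 kb) ltry.
  apply: filterS2 (Joo _ _ mkp kp0 kpE) (Joo _ _ mkn kn0 knE) => w Jp Jn.
  have J0 (k : R -> R) : (forall z, 0 <= k z) ->
      (0 <= \int[mu w]_v (noise_fun (d := d) t k v)%:E)%E.
    by move=> k0; apply: integral_ge0 => v _; rewrite lee_fin noise_fun_ge0.
  have Jpf : (\int[mu w]_v (noise_fun (d := d) t kp v)%:E)%E \is a fin_num.
    by rewrite ge0_fin_numE// J0.
  have Jnf : (\int[mu w]_v (noise_fun (d := d) t kn v)%:E)%E \is a fin_num.
    by rewrite ge0_fin_numE// J0.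
  rewrite YE// driftE /poisson_integral fineB//.
  by field; rewrite gt_eqF.
have main' (e : R) : 0 < e -> \forall t \near +oo%R,
    (\int[P]_w (`|Y0 t w / t - m| `^ p')%:E <= e%:E)%E.
  move=> e0; have e'0 : 0 < e / (2 * 2 `^ p') by rewrite divr_gt0 ?mulr_gt0 ?powR_gt0.
  apply: filterS3 (nbhs_pinfty_gt (num_real 0)) (hp _ e'0) (hn _ e'0) => t t0 Sp Sn.
  have mS (k : R -> R) b : measurable_fun setT k -> (forall z, 0 <= k z) ->
      measurable_fun setT (fun w => poisson_integral mu (noise_fun (d := d) t k) w / t - b).
    move=> mk k0; apply: measurable_funB => //; apply: measurable_funM => //.
    apply: (measurable_poisson_integral hN).
    - by move=> v; exact: noise_fun_ge0.
    - exact: measurable_noise_fun.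
  have := integral_powR_norm_sub_le p'0 (mY t t0) (mS _ bp mkp kp0) (mS _ bn mkn kn0)
    (Yae t t0) Sp Sn.
  rewrite (_ : 2 `^ p' * _ = e)//.
  by field; rewrite gt_eqF// powR_gt0.
have mYp (t r : R) : 0 < t -> measurable_fun setT (fun w => `|Y0 t w / t - m| `^ r).
  by move=> t0; apply: measurable_fun_powR; apply: measurableT_comp => //; exact: mY.
have main (e : R) : 0 < e -> \forall t \near +oo%R,
    (\int[P]_w (`|Y0 t w / t - m| `^ p)%:E <= e%:E)%E.
  move=> e0; have e20 : 0 < e / 2 by rewrite divr_gt0.
  (* The constant of [powR_le_eps_powR] at e/2; the moment of order p' is then required to be at
     most e / (2 K). *)
  pose K := (((e / 2) `^ p^-1) `^ (p' - p))^-1.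
  have K0 : 0 < K by rewrite invr_gt0 !powR_gt0.
  have Ke0 : 0 < K^-1 * (e / 2) by apply: mulr_gt0 => //; rewrite invr_gt0.
  apply: filterS2 (nbhs_pinfty_gt (num_real 0)) (main' _ Ke0) => t t0 IY.
  apply: (@le_trans _ _ (\int[P]_w (e / 2 + K * `|Y0 t w / t - m| `^ p')%:E)%E).
    apply: ge0_le_integral_EFin.
    - exact: mYp.
    - by apply: measurable_funD => //; apply: measurable_funM => //; exact: mYp.
    - by move=> w; exact: powR_ge0.
    - by move=> w; exact: powR_le_eps_powR.
  rewrite ge0_integralD_EFin//; last 3 first.
  - by apply: measurable_funM => //; exact: mYp.
  - by move=> _; exact: ltW.
  - by move=> w; rewrite mulr_ge0 ?powR_ge0// ltW.
  rewrite integral_probability_cst ge0_integralZl_EFin_fun ?(ltW K0)//; last exact: mYp.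
  apply: (@le_trans _ _ ((e / 2)%:E + K%:E * (K^-1 * (e / 2))%:E)%E).
    by rewrite leeD2l// lee_wpmul2l// lee_fin ltW.
  rewrite -EFinM -EFinD lee_fin mulrA divff ?gt_eqF// mul1r; lra.
under eq_fun do rewrite unlock.
have I0 t : (0 <= \int[P]_w (`|Y0 t w / t - m| `^ p)%:E)%E.
  by apply: integral_ge0 => w _; rewrite lee_fin powR_ge0.
apply/fine_cvgP; split.
  near=> t; rewrite ge0_fin_numE//.
  by apply: (@le_lt_trans _ _ 1%:E); [near: t; exact: main|exact: ltry].
apply/cvgr0Pnorm_le => e e0; near=> t.
rewrite /= ger0_norm ?fine_ge0//.
have h : (\int[P]_w (`|Y0 t w / t - m| `^ p)%:E <= e%:E)%E by near: t; exact: main.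
by rewrite -lee_fin fineK// ge0_fin_numE// (le_lt_trans h (ltry _)).
Unshelve. all: by end_near. Qed.
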